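(* Let $G=(V,E)$ be a graph whose graphic matroid $M$ has rank $r\ge 2$, let $\mathcal{X}=(X_1,X_2)$ and $\mathcal{Y}=(Y_1,Y_2)$ be compatible pairs of bases of $M$, and let $F\subseteq (X_1\cap Y_1)\cup(X_2\cap Y_2)$ be such that $|V(F)|\le 3$, where $V(F)$ denotes the set of vertices of the edges in $F$. Then there exists an $F$-avoiding $\mathcal{X}$-$\mathcal{Y}$ exchange sequence of width at most $2\cdot(r-1)$ and length at most $r^2$.
   Context: Graphs are loopless but may contain parallel edges. For a set $X$ and elements $e,f$, write $X-e+f=(X\setminus\{e\})\cup\{f\}$. A pair of bases is an ordered pair $(X_1,X_2)$ of (not necessarily disjoint) bases of $M$. If $e\in X_1\setminus X_2$ and $f\in X_2\setminus X_1$ are such that $X_1-e+f$ and $X_2+e-f$ are both bases, then $(X_1-e+f,\,X_2+e-f)$ is obtained from $(X_1,X_2)$ by a symmetric exchange, which uses (involves) the elements $e$ and $f$. Two pairs are compatible if $X_1\cap X_2=Y_1\cap Y_2$ and $X_1\cup X_2=Y_1\cup Y_2$. An $\mathcal{X}$-$\mathcal{Y}$ exchange sequence is a sequence of symmetric exchanges transforming $\mathcal{X}$ into $\mathcal{Y}$; its length is the number of exchanges, its width is the maximum number of exchanges in it using any one element, and it is $F$-avoiding if no exchange in it uses an element of $F$. *)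

(* Defs.v *)
From HB Require Import structures.
From mathcomp Require Import all_boot all_order all_algebra.

Set Implicit Arguments.
Unset Strict Implicit.
Unset Printing Implicit Defensive.

Import GRing.Theory.

Record multigraph (V E : finType) := Multigraph {
  ends : E -> {set V};
  (* two distinct ends, hence no loops; ends need not be injective *)
  card_ends : forall e, #|ends e| = 2
}.

Record matroid (E : finType) := Matroid {
  indep : pred {set E};
  indep0 : indep set0;
  indepS : forall A B : {set E}, A \subset B -> indep B -> indep A;
  indep_augment : forall A B : {set E}, indep A -> indep B -> #|A| < #|B| ->
    exists2 e, e \in B :\: A & indep (e |: A)
}.

Section Matroid.

Variables (E : finType) (M : matroid E).

Definition basis (B : {set E}) : bool := maxset (indep M) B.

Definition rank : nat := \max_(A : {set E} | indep M A) #|A|.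

Definition basis_pair (X : {set E} * {set E}) : bool :=
  basis X.1 && basis X.2.

(* An exchange step is recorded as the pair (e, f) of the elements it uses. *)
Definition exchange (X : {set E} * {set E}) (s : E * E) : {set E} * {set E} :=
  (s.2 |: (X.1 :\ s.1), s.1 |: (X.2 :\ s.2)).

Definition symmetric_exchange (X : {set E} * {set E}) (s : E * E) : bool :=
  [&& s.1 \in X.1 :\: X.2, s.2 \in X.2 :\: X.1 & basis_pair (exchange X s)].

Fixpoint exchange_sequence (X : {set E} * {set E}) (S : seq (E * E))
    (Y : {set E} * {set E}) : bool :=
  if S is s :: S' then
    symmetric_exchange X s && exchange_sequence (exchange X s) S' Y
  else X == Y.

End Matroid.

Section Sequences.

Variable E : finType.

Definition compatible (X Y : {set E} * {set E}) : Prop :=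
  X.1 :&: X.2 = Y.1 :&: Y.2 /\ X.1 :|: X.2 = Y.1 :|: Y.2.

Definition uses (s : E * E) (e : E) : bool := (e == s.1) || (e == s.2).

Definition width (S : seq (E * E)) : nat :=
  \max_(e : E) count (fun s => uses s e) S.

Definition avoiding (F : {set E}) (S : seq (E * E)) : bool :=
  all (fun s => [forall e in F, ~~ uses s e]) S.

End Sequences.

Section GraphicMatroid.

Variables (V E : finType) (G : multigraph V E).

Definition cycle_step (p q : V * E) : bool := ends G p.2 == [set p.1; q.1].

(* [:: (v_0, e_0); ...; (v_k-1, e_k-1)] with distinct vertices and distinct
   edges such that e_i joins v_i and v_(i+1 mod k).  Since G is loopless,
   k >= 2; two parallel edges form a cycle with k = 2. *)
Definition graph_cycle (c : seq (V * E)) : bool :=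
  [&& c != [::], uniq (unzip1 c), uniq (unzip2 c)
    & cycle cycle_step c].

(* The edges of a cycle are distinct, so its length is at most #|E|; this
   bound only serves to make the predicate boolean, see forestP. *)
Definition forest (A : {set E}) : bool :=
  [forall k : 'I_#|E|.+1, forall c : k.-tuple (V * E),
     graph_cycle c ==> ~~ all (fun e => e \in A) (unzip2 c)].

Definition vertices_of (F : {set E}) : {set V} := \bigcup_(e in F) ends G e.

Lemma forestP (A : {set E}) :
  reflect (forall c, graph_cycle c -> ~ {subset unzip2 c <= A}) (forest A).
Proof.
apply: (iffP forallP) => [fA c cyc sub|fA k]; last first.
  apply/forallP => c; apply/implyP => cyc; apply/negP => /allP.
  exact: fA.
have le_c : size c < #|E|.+1.
  case/and4P: (cyc) => _ _ /card_uniqP uc _.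
  by rewrite ltnS -(size_map snd c) -uc max_card.
have /forallP/(_ (in_tuple c)) := fA (Ordinal le_c).
by rewrite /= cyc /= => /negP; apply; apply/allP.
Qed.

Definition adj (A : {set E}) : rel V :=
  fun u v => [exists e in A, ends G e == [set u; v]].

Lemma set2C (u v : V) : [set u; v] = [set v; u].
Proof. by rewrite setUC. Qed.

Lemma adj_sym (A : {set E}) : symmetric (adj A).
Proof. by move=> u v; rewrite /adj set2C. Qed.

Lemma neq_ends e u v : ends G e = [set u; v] -> u != v.
Proof. by move=> h; have := card_ends G e; rewrite h cards2; case: eqP. Qed.

Lemma adj_walk (A : {set E}) u p w : path (adj A) u p -> uniq (u :: p) ->
  last u p = w -> forall e0, exists c : seq (V * E),
  [/\ unzip1 (rcons c (w, e0)) = u :: p, uniq (unzip2 c),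
      {subset unzip2 c <= A},
      path cycle_step (head (w, e0) (rcons c (w, e0)))
                (behead (rcons c (w, e0)))
    & {in unzip2 c, forall e, ends G e \subset u :: p}].
Proof.
elim: p u => [|x p IH] u /=.
  by move=> _ _ <- e0; exists [::].
case/andP => /existsP [e /andP [eA /eqP he]] pp /andP [ux ux2] lw e0.
have [c [h1 h2 h3 h4 h5]] := IH x pp ux2 lw e0.
exists ((u, e) :: c); split.
- by rewrite /= h1.
- rewrite /= h2 andbT; apply/negP => /h5 /subsetP /(_ u).
  by rewrite he set21 => /(_ isT); apply/negP.
- by move=> f; rewrite inE => /orP [/eqP ->|/h3].
- rewrite /=; move: h1 h4; case: (c) => [|[y f] c'] /= [-> _].
    by rewrite /cycle_step /= he eqxx.
  by move=> ->; rewrite /cycle_step /= he eqxx.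
- move=> f; rewrite inE => /orP [/eqP ->|/h5 /subsetP h].
    by rewrite he; apply/subsetP => z; rewrite !inE => /orP [] ->; rewrite ?orbT.
  by apply/subsetP => z /h zin; rewrite in_cons zin orbT.
Qed.

Lemma forest_bridge (A : {set E}) e u v : forest A -> e \in A -> ends G e = [set u; v] ->
  ~~ connect (adj (A :\ e)) u v.
Proof.
move=> /forestP fA eA he; apply/negP => /connectP [p pp lv].
case/shortenP: pp lv => p' pp up _ lv.
have [c [h1 h2 h3 h4 _]] := adj_walk pp up (esym lv) e.
apply: (fA (rcons c (v, e))).
  apply/and4P; split.
  - by case: (c).
  - by rewrite h1.
  - rewrite /unzip2 map_rcons rcons_uniq h2 andbT.
    by apply/negP => /h3; rewrite !inE eqxx.
  - move: h1 h4; case: (c) => [|q c'] /=.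
      by case=> vu; have := neq_ends he; rewrite vu eqxx.
    case=> q1 _ h4; rewrite rcons_path h4 last_rcons /cycle_step /=.
    by rewrite he q1 set2C.
move=> f; rewrite /unzip2 map_rcons mem_rcons inE => /orP [/eqP ->//|/h3].
by rewrite !inE => /andP [].
Qed.

Lemma walk_connect (A : {set E}) p q c : path cycle_step p c ->
  {subset unzip2 (belast p c) <= A} -> q = last p c ->
  connect (adj A) p.1 q.1.
Proof.
elim: c p => [|x c IH] p /=; first by move=> _ _ ->.
case/andP => px pc sub lq; apply: (connect_trans (y := x.1)).
  apply: connect1; apply/existsP; exists p.2.
  by rewrite sub ?inE ?eqxx.
by apply: IH => // f fc; apply: sub; rewrite inE fc orbT.
Qed.

Lemma forest_add (A : {set E}) e u v : forest A -> ends G e = [set u; v] ->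
  ~~ connect (adj A) u v -> forest (e |: A).
Proof.
move=> /forestP fA he nc; apply/forestP => c cyc sub.
have [ec|ec] := boolP (e \in unzip2 c); last first.
  apply: (fA c cyc) => f fc; have := sub f fc; rewrite !inE.
  by case/orP => // /eqP fe; rewrite -fe fc in ec.
case/mapP: ec => -[w e'] /= wc ee'; subst e'.
have [i c' rc] := rot_to wc.
case/and4P: cyc => _ _ u2 cy.
have u2' : uniq (unzip2 ((w, e) :: c')) by rewrite -rc /unzip2 map_rot rot_uniq.
have cy' : cycle cycle_step ((w, e) :: c') by rewrite -rc rot_cycle.
have sub' : {subset unzip2 c' <= A}.
  move=> f fc; have := sub f; rewrite -(mem_rot i) -map_rot rc /= !inE fc orbT.
  case/(_ isT)/orP => // /eqP fe; move: u2' => /=.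
  by rewrite -fe fc.
case: c' cy' sub' {rc u2'} => [|x c'] /=.
  by rewrite andbT /cycle_step /= => /eqP /neq_ends; rewrite eqxx.
rewrite {1}/cycle_step /= => /andP [/eqP hw px] sub'.
have cw : connect (adj A) x.1 w.
  by apply: (walk_connect (q := (w, e)) px); rewrite ?last_rcons // belast_rcons.
have csym := sym_connect_sym (adj_sym A).
apply/negP: nc; apply/negPn.
have : u \in [set w; x.1] by rewrite -hw he set21.
have : v \in [set w; x.1] by rewrite -hw he set22.
have nuv := neq_ends he.
rewrite !inE => /orP [] /eqP hv /orP [] /eqP hu; rewrite hu hv ?eqxx in nuv *.
- by [].
- by [].
- by rewrite csym.
- by [].
Qed.

(* Rows of the incidence matrix over F_2: independence of these vectors is
   equivalent to being a forest, which gives the augmentation property. *)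
Local Open Scope ring_scope.

Local Notation Fvec := {ffun V -> ('F_2)^o}.

Definition point (v : V) : Fvec := [ffun w => (w == v)%:R].
Definition incidence (e : E) : Fvec := [ffun v => (v \in ends G e)%:R].

Lemma F2_add (a : 'F_2) : a + a = 0.
Proof. by apply/eqP; case: a => [[|[|]]]. Qed.

Lemma addvv (x : Fvec) : x + x = 0.
Proof. by apply/ffunP => v; rewrite !ffunE F2_add. Qed.

Lemma incidenceE e u v : ends G e = [set u; v] ->
  incidence e = point u + point v.
Proof.
move=> he; apply/ffunP => w; rewrite !ffunE he !inE.
have := neq_ends he.
by case: (w =P u) => [->|_] /=; [move/negPf->; rewrite addr0|rewrite add0r].
Qed.

Lemma ends_pair e : exists u v, ends G e = [set u; v].
Proof. by have /eqP/cards2P [u [v [_ ->]]] := card_ends G e; exists u, v. Qed.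

Lemma connect_span (A : {set E}) u v : connect (adj A) u v ->
  point u + point v \in <<map incidence (enum A)>>%VS.
Proof.
case/connectP => p; elim: p u => [|x p IH] u /=.
  by move=> _ ->; rewrite addvv mem0v.
case/andP => /existsP [e /andP [eA /eqP he]] pp lv.
have -> : point u + point v = incidence e + (point x + point v).
  by rewrite (incidenceE he) -addrA (addrA (point x)) addvv add0r.
by rewrite rpredD ?IH // memv_span // map_f // mem_enum.
Qed.

Lemma forest_free (A : {set E}) : forest A -> free (map incidence (enum A)).
Proof.
move=> fA.
have sz : size (map incidence (enum A)) == #|A| by rewrite size_map cardE.
rewrite -[map _ _]/(val (Tuple sz)); apply/freeP => /= k sum0 i.
have iA (j : 'I_#|A|) : (j < size (enum A))%N by rewrite -cardE.
have e0 : E by have := iA i; case: (enum A) => [|x].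
pose en (j : 'I_#|A|) := nth e0 (enum A) j.
have enA j : en j \in A by rewrite -mem_enum mem_nth.
have [u [v he]] := ends_pair (en i).
pose D := A :\ en i.
pose h w : 'F_2 := (connect (adj D) u w)%:R.
pose phi (x : Fvec) : 'F_2 := \sum_w h w * x w.
have phi_point w : phi (point w) = h w.
  rewrite /phi (bigD1 w) //= ffunE eqxx mulr1 big1 ?addr0 // => z /negPf zw.
  by rewrite ffunE zw mulr0.
have phiD x y : phi (x + y) = phi x + phi y.
  by rewrite /phi -big_split; apply: eq_bigr => w _; rewrite ffunE mulrDr.
have phiZ c (x : Fvec) : phi (c *: x) = c * phi x.
  rewrite /phi mulr_sumr; apply: eq_bigr => w _; rewrite ffunE.
  by rewrite mulrCA.
have phi0 : phi 0 = 0 by rewrite /phi big1 // => w _; rewrite ffunE mulr0.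
have phi_i : phi (incidence (en i)) = 1.
  rewrite (incidenceE he) phiD !phi_point /h connect0.
  by rewrite (negPf (forest_bridge fA (enA i) he)) addr0.
have phi_j j : j != i -> phi (incidence (en j)) = 0.
  move=> ji; have [x [y hj]] := ends_pair (en j).
  have jD : en j \in D.
    rewrite !inE enA andbT /en nth_uniq ?enum_uniq //.
  have xy : adj D x y by apply/existsP; exists (en j); rewrite jD hj eqxx.
  rewrite (incidenceE hj) phiD !phi_point /h.
  have -> : connect (adj D) u y = connect (adj D) u x.
    rewrite !(sym_connect_sym (adj_sym D) u).
    by rewrite (same_connect1 (sym_connect_sym (adj_sym D)) xy).
  exact: F2_add.
have := congr1 phi sum0; rewrite phi0.
rewrite (big_morph phi phiD phi0) (bigD1 i) //= big1 => [|j ji].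
  by rewrite (nth_map e0) // phiZ phi_i mulr1 addr0.
by rewrite (nth_map e0) // phiZ (phi_j j ji) mulr0.
Qed.

Local Close Scope ring_scope.

Lemma forest0 : forest set0.
Proof.
apply/forestP => -[|[v e] c] // _ sub.
by have := sub e (mem_head _ _); rewrite inE.
Qed.

Lemma forestS (A B : {set E}) : A \subset B -> forest B -> forest A.
Proof.
move=> /subsetP sAB /forestP fB; apply/forestP => c cyc sub.
by apply: (fB c cyc) => e /sub /sAB.
Qed.

Lemma forest_augment (A B : {set E}) : forest A -> forest B -> #|A| < #|B| ->
  exists2 e, e \in B :\: A & forest (e |: A).
Proof.
move=> fA fB ltAB.
have [/existsP [e /andP [eB ef]]|] :=
  boolP [exists e, (e \in B :\: A) && forest (e |: A)]; first by exists e.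
rewrite negb_exists => /forallP none; exfalso; move: ltAB; apply/negP.
rewrite -leqNgt !cardE -!(size_map incidence).
rewrite -(eqnP (forest_free fB)); apply: leq_trans (dim_span _).
apply/dimvS/span_subvP => x /mapP [e]; rewrite mem_enum => eB ->.
have [eA|eA] := boolP (e \in A).
  by rewrite memv_span // map_f // mem_enum.
have [u [v he]] := ends_pair e.
rewrite (incidenceE he) connect_span //; apply/negPn/negP => nc.
by have := none e; rewrite inE eA eB (forest_add fA he nc).
Qed.

Definition graphic_matroid : matroid E :=
  Matroid forest0 forestS forest_augment.

End GraphicMatroid.

(* Main.v *)
Require Import Defs.
From mathcomp Require Import all_boot zify.

Set Implicit Arguments.
Unset Strict Implicit.
Unset Printing Implicit Defensive.

(** Contract the edges common to the two bases of X (they are also those common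
    to the bases of Y) and glue the components of the graph together.  Both pairs
    become pairs of disjoint spanning trees, with the same union D, of a connected
    graph on n + 1 vertices with n <= r, and exchanges lift back unchanged.  The
    theorem for such pairs ([tree_pairs_exchange]) is proved by induction on n,
    with length at most n ^ 2 and width at most max (1, 2 (n - 1)).

    Since #|D| = 2 n, the degrees add up to 4 n, which is 4 less than four times
    the number of vertices; and every degree is at least 2 because both trees reach
    every vertex.  So the vertices of degree below 4 have total deficiency at least
    4.  As F touches at most three vertices, there is a vertex of degree 2, or else
    a vertex of degree 3 outside V(F), and in the latter case n >= 3
    ([low_degree]).

    At a vertex v of degree 2 each tree has one edge, so v can be deleted; if the
    two edges at v have to trade places, one exchange of them is appended to the
    sequence of the smaller graph ([exchange_at_degree2]).

    At a vertex v of degree 3 with edges p, q, s, one tree contains two of them, say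
    p and q, and the other contains only s.  Suppose that s is alone in X and in Y.
    Contract q and delete s; the edge p now stands for the path formed by p and q.
    An exchange of the smaller graph that moves another edge lifts to itself, and
    one that trades p for f lifts to two exchanges, which use f, p, q and s once each
    ([exseq_expand]).  The smaller sequence uses p at most 2 (n - 2) times, so the
    length grows by at most that much and the width does not grow.  If different
    edges are alone in X and in Y, note that from any pair one exchange makes
    another edge at v alone ([star3_move]).  There are only three candidates, so one
    such exchange at one or both ends of the sequence makes the lonely edges agree.
    In total the length is at most (n - 1) ^ 2 + 2 (n - 2) + 2 <= n ^ 2, and the
    width at most 2 (n - 2) + 2 = 2 (n - 1). *)

(** * Connectivity by potentials *)

Section Potentials.

Variables (E V : finType).
Implicit Types (en : E -> V * V) (T D A F : {set E}) (W : {set V}) (e : E).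

Definition flat en T (p : V -> bool) := {in T, forall e, p (en e).1 = p (en e).2}.

(** Connectivity in terms of cuts: no set of vertices separates two elements of W
    unless an edge of T crosses it.  Unlike paths, potentials are easy to pull back
    along maps of vertices, which makes contraction and deletion arguments short. *)
Definition spans en W T :=
  forall p, flat en T p -> {in W &, forall x y, p x = p y}.

Definition tree en W T := spans en W T /\ #|W| = #|T|.+1.

Definition merge (v w x : V) := if x == v then w else x.

Definition contract v w en e := (merge v w (en e).1, merge v w (en e).2).

Definition joins en e x y := en e = (x, y) \/ en e = (y, x).

Lemma flatU1 en T e x y p : joins en e x y ->
  flat en (e |: T) p <-> p x = p y /\ flat en T p.
Proof.
move=> j; split=> [fp|[pxy fp] f].
  split=> [|f fT]; last by apply: fp; rewrite !inE fT orbT.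
  by have := fp e (setU11 _ _); case: j => ->.
by rewrite !inE => /predU1P[->|/fp//]; case: j => ->.
Qed.

Lemma eq_flat en en' T p : {in T, en =1 en'} -> flat en T p -> flat en' T p.
Proof. by move=> eqe fp e eT; rewrite -eqe // fp. Qed.

Lemma spans_eq en en' W T : {in T, en =1 en'} -> spans en W T -> spans en' W T.
Proof. by move=> eqe sp p fp; apply: sp; apply: eq_flat fp => e /eqe. Qed.

Lemma tree_eq en en' W T : {in T, en =1 en'} -> tree en W T -> tree en' W T.
Proof. by move=> eqe [sp cT]; split=> //; apply: spans_eq sp. Qed.

(** The potentials on a finite set of vertices can be searched for one that
    separates. *)
Lemma spansVcut en W T : spans en W T \/
  exists2 p, flat en T p & exists x y, [/\ x \in W, y \in W & p x != p y].
Proof.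
have [/existsP[p /andP[/forall_inP fp /existsP[x /existsP[y /and3P[xW yW pxy]]]]]|] :=
  boolP [exists p : {ffun V -> bool},
    [forall e in T, p (en e).1 == p (en e).2] &&
    [exists x, exists y, [&& x \in W, y \in W & p x != p y]]].
  by right; exists p; [move=> e /fp /eqP | exists x, y].
rewrite negb_exists => /forallP np; left=> p fp x y xW yW.
apply/eqP; apply: contraNT (np (finfun p)) => pxy; apply/andP; split.
  by apply/forall_inP => e eT; rewrite !ffunE fp.
by apply/existsP; exists x; apply/existsP; exists y; rewrite xW yW !ffunE.
Qed.

Lemma merge_id v w x : x != v -> merge v w x = x.
Proof. by rewrite /merge => /negPf->. Qed.

Lemma merge_refl v w : merge v w v = w.
Proof. by rewrite /merge eqxx. Qed.

Lemma contract_id v w en e : (en e).1 != v -> (en e).2 != v -> contract v w en e = en e.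
Proof. by move=> h1 h2; rewrite /contract !merge_id //; case: (en e). Qed.

Lemma flat_contract v w en T p : p v = p w ->
  flat (contract v w en) T p <-> flat en T p.
Proof.
move=> pvw; have pm x : p (merge v w x) = p x.
  by rewrite /merge; case: eqP => // ->.
by split=> fp e /fp; rewrite /= !pm.
Qed.

(** A potential on the contracted graph extends to v by its value at w. *)
Lemma spans_contract_weak v w en W T e : joins en e v w ->
  spans en W (e |: T) -> spans (contract v w en) (W :\ v) T.
Proof.
move=> j sp p fp x y; rewrite !inE => /andP[xv xW] /andP[yv yW].
rewrite -(merge_id w xv) -(merge_id w yv).
apply: (sp (p \o merge v w)) => //; apply/flatU1; [exact: j|split; last exact: fp].
by rewrite /= /merge eqxx; case: eqP.
Qed.

Lemma spans_contract v w en W T e : joins en e v w -> w \in W :\ v ->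
  spans en W (e |: T) <-> spans (contract v w en) (W :\ v) T.
Proof.
move=> j wW; split; first exact: spans_contract_weak.
move=> sp p /(flatU1 _ _ j) [pvw fp] x y xW yW.
have key z : z \in W -> p z = p w.
  move=> zW; have [->//|zv] := eqVneq z v.
  by apply: (sp p) => //; [apply/(flat_contract _ _ pvw)|rewrite !inE zv].
by rewrite !key.
Qed.

Lemma tree_contract v w en W T e : joins en e v w -> v \in W -> w \in W :\ v ->
  e \notin T -> tree en W (e |: T) <-> tree (contract v w en) (W :\ v) T.
Proof.
move=> j vW wW eT; have := spans_contract T j wW; rewrite /tree.
by rewrite (cardsD1 v W) vW cardsU1 eT !add1n => -> ; split=> -[? h]; split=> //; lia.
Qed.

(** Contracting one edge loses at most one vertex, and without edges all potentials
    are flat, so that at most one vertex is left at the end. *)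
Lemma spans_card en W T : spans en W T -> #|W| <= #|T|.+1.
Proof.
move: {2}#|T| (leqnn #|T|) => n.
elim: n => [|n IH] in en W T *; last first.
  move=> leT sp; have [T0|[e eT]] := set_0Vmem T.
    by rewrite T0 in sp leT *; apply: (IH en); rewrite ?cards0.
  have cT := cardsD1 e T; rewrite eT in cT.
  have jn : joins en e (en e).1 (en e).2 by left; case: (en e).
  have := spans_contract_weak (T := T :\ e) jn; rewrite setD1K // => /(_ _ sp)/IH.
  by have := cardsD1 (en e).1 W; lia.
rewrite leqn0 cards_eq0 => /eqP-> sp; rewrite cards0; apply/card_le1P => x xW y.
rewrite !inE; apply/idP/eqP => [yW|->//].
have /(_ _ x y xW yW) := sp (pred1 x); rewrite /= eqxx => /(_ _)/esym/eqP; apply.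
by move=> e; rewrite inE.
Qed.

(** Removing a loop would keep the graph connected with too few edges. *)
Lemma tree_loopless en W T e : tree en W T -> e \in T -> (en e).1 != (en e).2.
Proof.
move=> [sp cW] eT; apply/eqP => loop.
have /spans_card : spans en W (T :\ e).
  move=> p fp; apply: sp => f fT; have [->|fe] := eqVneq f e; first by rewrite loop.
  by apply: fp; rewrite !inE fe.
by rewrite cW [#|T|](cardsD1 e) eT; lia.
Qed.

Definition incident en v e := (v == (en e).1) || (v == (en e).2).

Lemma incident_joins en v e : incident en v e -> exists w, joins en e v w.
Proof.
by rewrite /incident /joins; case: (en e) => x y /orP[]/eqP->; [exists y; left|exists x; right].
Qed.

Lemma spans_incident en W T v : spans en W T -> 1 < #|W| -> v \in W ->
  exists2 e, e \in T & incident en v e.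
Proof.
move=> sp W1 vW; apply/exists_inP; apply/contraT; rewrite negb_exists => /forallP ne.
have /(_ _) : flat en T (pred1 v).
  move=> e eT; have := ne e; rewrite eT /incident /=.
  by rewrite negb_or ![v == _]eq_sym => /andP[/negPf-> /negPf->].
move/sp => c; have /card_gt0P[w] : 0 < #|W :\ v| by rewrite (cardsD1 v) vW in W1.
by rewrite !inE => /andP[wv wW]; have := c v w vW wW; rewrite /= eqxx (negPf wv).
Qed.

(** Contract an edge that is not a loop, take a tree there and put the edge back. *)
Lemma spans_tree en W T : W != set0 ->
  {in T, forall e, (en e).1 \in W /\ (en e).2 \in W} -> spans en W T ->
  exists2 T' : {set E}, T' \subset T & tree en W T'.
Proof.
have [n] := ubnP #|W|; elim: n => // n IH in en W T *.
rewrite ltnS => leW /set0Pn[v vW] inW sp.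
have [W1|W1] := leqP #|W| 1.
  exists set0; rewrite ?sub0set //; have /eqP c1 : #|W| == 1.
    by rewrite eqn_leq W1; apply/card_gt0P; exists v.
  split; last by rewrite cards0.
  by have /eqP/cards1P[z ->] := c1 => p _ x y /set1P-> /set1P->.
have [p [e eT]] : exists p : V -> bool, exists2 e, e \in T & p (en e).1 != p (en e).2.
  exists (pred1 v); apply/exists_inP; apply/contraT; rewrite negb_exists => /forallP ne.
  have /sp c : flat en T (pred1 v).
    by move=> e eT; have := ne e; rewrite eT negbK => /eqP.
  have /card_gt0P[w] : 0 < #|W :\ v| by rewrite (cardsD1 v) vW in W1.
  by rewrite !inE => /andP[wv wW]; have := c v w vW wW; rewrite /= eqxx (negPf wv).
move=> pe; have loop : (en e).1 != (en e).2 by apply: contraNneq pe => ->.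
have [xW yW] := inW e eT; set x := (en e).1 in loop xW; set y := (en e).2 in loop yW.
have jn : joins en e x y by left; rewrite /x /y; case: (en e).
have yWx : y \in W :\ x by rewrite !inE eq_sym loop.
have mW z : z \in W -> merge x y z \in W :\ x.
  by move=> zW; rewrite /merge; case: ifPn => // zx; rewrite !inE zx.
have [||||T' sT' tT'] := IH (contract x y en) (W :\ x) (T :\ e).
- by have := cardsD1 x W; rewrite xW; lia.
- by apply/set0Pn; exists y.
- by move=> f /setD1P[_ /inW[? ?]]; rewrite !mW.
- by apply/(spans_contract _ jn); rewrite ?setD1K.
exists (e |: T'); first by rewrite subUset sub1set eT (subset_trans sT') ?subsetDl.
by apply/(tree_contract jn) => //; apply/negP => /(subsetP sT'); rewrite !inE eqxx.
Qed.

End Potentials.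

(** * Exchange sequences *)

Section ExchangeSequences.

Variable E : finType.
Local Notation pair := ({set E} * {set E})%type.
Implicit Types (X Y Z : pair) (S : seq (E * E)) (D T : {set E}) (B : {set E} -> Prop).

(** The bases enter only through an arbitrary predicate, so that spanning trees of
    all graphs met during the induction can play their role. *)
Fixpoint exseq B X S Y : Prop :=
  if S is s :: S' then
    [/\ s.1 \in X.1 :\: X.2, s.2 \in X.2 :\: X.1, B (exchange X s).1,
        B (exchange X s).2 & exseq B (exchange X s) S' Y]
  else X = Y.

Definition cnt e S := count (fun s => uses s e) S.

(** The pairs compatible with a disjoint pair of union D. *)
Definition splits D X := X.1 \subset D /\ X.2 = D :\: X.1.

Lemma splitsE D X e : splits D X -> (e \in X.2) = (e \in D) && (e \notin X.1).
Proof. by case=> _ ->; rewrite inE andbC. Qed.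

Lemma splits_in1 D X e : splits D X -> e \in X.1 -> e \in D.
Proof. by case=> /subsetP h _ /h. Qed.

Lemma cnt_cat e S1 S2 : cnt e (S1 ++ S2) = cnt e S1 + cnt e S2.
Proof. exact: count_cat. Qed.

Lemma exseq_cat B X S1 Y S2 Z : exseq B X S1 Y -> exseq B Y S2 Z ->
  exseq B X (S1 ++ S2) Z.
Proof. by elim: S1 X => [|s S1 IH] X /=; [move=> ->|case=> ? ? ? ? /IH h /h]. Qed.

Lemma splits_swap D X : splits D X -> splits D (X.2, X.1).
Proof.
move=> [/subsetP sX eX]; rewrite /splits /= eX subsetDl; split=> //.
apply/setP => e; rewrite !inE negb_and negbK; have := sX e.
by case: (e \in X.1) => //= [->|_] //; case: (e \in D).
Qed.

Lemma exseq_swap B X S Y : exseq B X S Y ->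
  exseq B (X.2, X.1) [seq (s.2, s.1) | s <- S] (Y.2, Y.1).
Proof. by elim: S X => [|s S IH] X /=; [move=> ->|case=> ? ? ? ? /IH]. Qed.

Lemma cnt_swap e S : cnt e [seq (s.2, s.1) | s <- S] = cnt e S.
Proof. by rewrite /cnt count_map; apply: eq_count => s; rewrite /= /uses /= orbC. Qed.

Lemma splits_exchange D X s : splits D X -> s.1 \in X.1 :\: X.2 -> s.2 \in X.2 :\: X.1 ->
  splits D (exchange X s).
Proof.
move=> sX; rewrite !inE !(splitsE _ sX) => /andP[_ s1] /andP[s21 /andP[s2 _]].
have s1D := splits_in1 sX s1; split=> /=.
  rewrite subUset sub1set s2; apply/subsetP => e; rewrite !inE => /andP[_].
  exact: splits_in1.
apply/setP => e; rewrite !inE (splitsE _ sX).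
have [->|e1] := eqVneq e s.1.
  by rewrite s1D /= orbF andbT; apply/esym; apply: contraNneq s21 => <-.
by have [//|e2] := eqVneq e s.2; rewrite /= andbC.
Qed.

Lemma exseq_unused B X S Y e : exseq B X S Y -> cnt e S = 0 ->
  (e \in Y.1 = (e \in X.1)) * (e \in Y.2 = (e \in X.2)).
Proof.
elim: S X => [|s S IH] X /=; first by move=> ->.
case=> _ _ _ _ /IH h /eqP; rewrite addn_eq0 eqb0 negb_or.
case/andP => /andP[/negPf e1 /negPf e2] /eqP/h.
by rewrite !inE e1 e2.
Qed.

Lemma exseq_cnt0 D B X S Y e : splits D X -> exseq B X S Y -> e \notin D -> cnt e S = 0.
Proof.
move=> + + eD; elim: S X => [//|s S IH] X sX [s1 s2 _ _ /IH h] /=.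
rewrite -/(cnt e S) h ?addn0; last exact: splits_exchange.
apply/eqP; rewrite eqb0 /uses; apply: contra eD.
move: s1 s2; rewrite !inE !(splitsE _ sX) => /andP[_ /(splits_in1 sX) ?].
by move=> /and3P[_ ? _] /orP[]/eqP->.
Qed.

(** Exchanges stay valid when A1 and A2 are put back: with A1 = A2 this undoes the
    contraction of common edges, and with two singletons it restores a vertex of
    degree 2. *)
Lemma exseq_add B B' (A1 A2 : {set E}) D X S Y : splits D X ->
  [disjoint A1 & D] -> [disjoint A2 & D] ->
  (forall T, T \subset D -> B' T -> B (A1 :|: T) /\ B (A2 :|: T)) ->
  exseq B' X S Y -> exseq B (A1 :|: X.1, A2 :|: X.2) S (A1 :|: Y.1, A2 :|: Y.2).
Proof.
move=> + dA1 dA2 BB'; elim: S X => [|s S IH] X sX /=; first by move=> ->.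
case=> s1 s2 B1 B2 /IH h; have sX' := splits_exchange sX s1 s2.
have D1 := splits_in1 sX'; have D2 := splits_in1 (splits_swap sX').
have [_ /negP s1A1] : s.1 \in D /\ ~ (s.1 \in A1).
  by split; [|move=> /(disjointFr dA1)]; rewrite D2 //= setU11.
have [_ /negP s1A2] : s.1 \in D /\ ~ (s.1 \in A2).
  by split; [|move=> /(disjointFr dA2)]; rewrite D2 //= setU11.
have [_ /negP s2A1] : s.2 \in D /\ ~ (s.2 \in A1).
  by split; [|move=> /(disjointFr dA1)]; rewrite D1 //= setU11.
have [_ /negP s2A2] : s.2 \in D /\ ~ (s.2 \in A2).
  by split; [|move=> /(disjointFr dA2)]; rewrite D1 //= setU11.
have eX : (A1 :|: (exchange X s).1, A2 :|: (exchange X s).2) =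
    exchange (A1 :|: X.1, A2 :|: X.2) s.
  rewrite /exchange /=; congr (_, _); apply/setP => e; rewrite !inE.
    have [->|_] := eqVneq e s.1; first by rewrite (negPf s1A1).
    by rewrite orbCA.
  have [->|_] := eqVneq e s.2; first by rewrite (negPf s2A2).
  by rewrite orbCA.
move: s1 s2; rewrite !inE (negPf s1A1) (negPf s1A2) (negPf s2A1) (negPf s2A2).
move=> s1 s2; split=> //; last by rewrite -eX; apply: h.
  by case: eX => <- _; apply: (BB' _ _ B1).1; apply/subsetP.
by case: eX => _ <-; apply: (BB' _ _ B2).2; apply/subsetP.
Qed.

(** * Lifting a sequence to a graph with an additional vertex of degree three

    The smaller graph has p in place of the path formed by p and q, and lacks s. *)

Section Expand.

Variables (B B' : {set E} -> Prop) (D : {set E}) (p q s : E).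
Hypotheses (pD : p \in D) (qD : q \notin D) (sD : s \notin D) (qs : q != s).
Hypothesis expand_in : forall T, T \subset D -> B' T -> p \in T -> B (q |: T).
Hypothesis expand_out : forall T y, T \subset D -> B' T -> p \notin T ->
  y \in [:: p; q; s] -> B (y |: T).
Hypothesis expand_mid : forall T, T \subset D -> B' (p |: T) -> p \notin T ->
  B (s |: (p |: T)) \/ B (s |: (q |: T)).

(** The pair of the larger graph that X stands for. *)
Definition expand X : pair :=
  if p \in X.1 then (q |: X.1, s |: X.2) else (s |: X.1, q |: X.2).

Lemma expand_swap X : splits D X -> expand (X.2, X.1) = ((expand X).2, (expand X).1).
Proof.
by move=> sX; rewrite /expand /= (splitsE _ sX) pD; case: (p \in X.1).
Qed.

Lemma neq_detached e : e \in D -> [/\ e != q, e != s & (e == q) = false /\ (e == s) = false].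
Proof.
move=> eD; have eq : e != q by apply: contraNneq qD => <-.
have es : e != s by apply: contraNneq sD => <-.
by split=> //; rewrite (negPf eq) (negPf es).
Qed.

(** The part that receives p loses f, and [expand_mid] says which of p and q may
    replace f there while s is still present.  Exchange f with that edge first, and
    the other one of p and q with s next. *)
Lemma expand_pivot_exchange X f : splits D X -> p \in X.1 -> f \in X.2 ->
  B' (exchange X (p, f)).1 -> B' (exchange X (p, f)).2 ->
  exists S, [/\ exseq B (expand X) S (expand (exchange X (p, f))), size S = 2
    & forall e, cnt e S = (e \in [:: f; p; q; s])].
Proof.
move=> sX p1 f2 B1 B2; have [fX1 fD] : f \notin X.1 /\ f \in D.
  by move: f2; rewrite (splitsE _ sX) => /andP[].
have pX2 : p \notin X.2 by rewrite (splitsE _ sX) p1 andbF.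
have fp : f != p by apply: contraNneq fX1 => ->.
have [pq ps _] := neq_detached pD; have [fq fs _] := neq_detached fD.
have qX1 : q \notin X.1 by apply: contra qD; apply: splits_in1.
have sX1 : s \notin X.1 by apply: contra sD; apply: splits_in1.
have qX2 : q \notin X.2 by rewrite (splitsE _ sX) (negPf qD).
have sX2 : s \notin X.2 by rewrite (splitsE _ sX) (negPf sD).
have s1 : X.1 \subset D by case: sX.
have s2 : X.2 \subset D by have [] := splits_swap sX.
have sub1 : f |: (X.1 :\ p) \subset D.
  by rewrite subUset sub1set fD (subset_trans (subsetDl _ _)).
have sub2 : X.2 :\ f \subset D by rewrite (subset_trans (subsetDl _ _)).
have nP1 : p \notin f |: (X.1 :\ p) by rewrite !inE eqxx orbF eq_sym.
have nP2 : p \notin X.2 :\ f by rewrite !inE (negPf pX2) andbF.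
rewrite /exchange /= in B1 B2.
have -> : expand (exchange X (p, f)) = (s |: (f |: (X.1 :\ p)), q |: (p |: (X.2 :\ f))).
  by rewrite /expand /= (negPf nP1).
rewrite /expand p1.
have nn (x y : E) : x != y -> ((x == y) = false) * ((y == x) = false).
  by move=> /negPf h; split; rewrite // eq_sym.
have ne := (nn _ _ pq, nn _ _ ps, nn _ _ fp, nn _ _ fq, nn _ _ fs, nn _ _ qs, eqxx).
have me := (negPf pX2, negPf fX1, negPf qX1, negPf sX1, negPf qX2, negPf sX2, p1, f2).
have spl e : [\/ e = p, e = q, e = s | e = f] \/
    [/\ e == p = false, e == q = false, e == s = false & e == f = false].
  case: (eqVneq e p) => [|/negPf hp]; first by left; constructor 1.
  case: (eqVneq e q) => [|/negPf hq]; first by left; constructor 2.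
  case: (eqVneq e s) => [|/negPf hs]; first by left; constructor 3.
  case: (eqVneq e f) => [|/negPf hf]; first by left; constructor 4.
  by right.
(* x is traded for f first, then y for s *)
have key x y : x != y -> x \in [:: p; q] -> y \in [:: p; q] ->
    B (s |: (x |: (X.2 :\ f))) ->
    exseq B (q |: X.1, s |: X.2) [:: (x, f); (y, s)]
      (s |: (f |: (X.1 :\ p)), q |: (p |: (X.2 :\ f))).
  move=> xy xpq ypq Bx.
  have By : B (y |: (f |: (X.1 :\ p))).
    by apply: expand_out => //; move: ypq; rewrite !inE => /orP[] ->; rewrite ?orbT.
  have Bs : B (s |: (f |: (X.1 :\ p))).
    by apply: expand_out; rewrite // !inE eqxx !orbT.
  have Bq : B (q |: (p |: (X.2 :\ f))).
    by apply: expand_in; rewrite ?setU11 // subUset sub1set pD.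
  have E1 : exchange (q |: X.1, s |: X.2) (x, f) =
      (y |: (f |: (X.1 :\ p)), s |: (x |: (X.2 :\ f))).
    move: xpq ypq xy; rewrite !inE => /orP[]/eqP-> /orP[]/eqP->; rewrite ?eqxx // => _;
    rewrite /exchange /=; congr (_, _); apply/setP => e; rewrite !inE;
    by case: (spl e) => [[->|->|->|->]|[h1 h2 h3 h4]]; rewrite ?h1 ?h2 ?h3 ?h4 ?ne ?me.
  have E2 : exchange (y |: (f |: (X.1 :\ p)), s |: (x |: (X.2 :\ f))) (y, s) =
      (s |: (f |: (X.1 :\ p)), q |: (p |: (X.2 :\ f))).
    move: xpq ypq xy; rewrite !inE => /orP[]/eqP-> /orP[]/eqP->; rewrite ?eqxx // => _;
    rewrite /exchange /=; congr (_, _); apply/setP => e; rewrite !inE;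
    by case: (spl e) => [[->|->|->|->]|[h1 h2 h3 h4]]; rewrite ?h1 ?h2 ?h3 ?h4 ?ne ?me.
  case: (E1) (E2) => E11 E12 [E21 E22].
  rewrite /= E1 E2 E11 E12 E21 E22; split=> //; [| |split=> //].
  - by move: xpq; rewrite !inE => /orP[]/eqP->; rewrite ?ne ?me.
  - by rewrite !inE ?ne ?me.
  - by move: xpq ypq xy; rewrite !inE => /orP[]/eqP-> /orP[]/eqP->; rewrite ?ne ?me.
  - by move: xpq ypq xy; rewrite !inE => /orP[]/eqP-> /orP[]/eqP->; rewrite ?ne ?me.
have [Bx|Bx] := expand_mid sub2 B2 nP2.
  exists [:: (p, f); (q, s)]; split=> //; first by apply: key; rewrite ?inE ?eqxx ?orbT.
  move=> e; rewrite /cnt /= /uses /= !inE.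
  by case: (spl e) => [[->|->|->|->]|[h1 h2 h3 h4]]; rewrite ?h1 ?h2 ?h3 ?h4 ?ne ?me.
exists [:: (q, f); (p, s)]; split=> //.
  by apply: key; rewrite ?inE ?eqxx ?orbT // eq_sym.
move=> e; rewrite /cnt /= /uses /= !inE.
by case: (spl e) => [[->|->|->|->]|[h1 h2 h3 h4]]; rewrite ?h1 ?h2 ?h3 ?h4 ?ne ?me.
Qed.

Lemma expand_B X : splits D X -> B' X.1 -> B' X.2 -> B (expand X).1 /\ B (expand X).2.
Proof.
move=> sX B1 B2; have [sub1 _] := sX; have [sub2 _] := splits_swap sX.
rewrite /expand; case: ifPn => p1; split=> /=.
- exact: expand_in.
- by apply: expand_out; rewrite ?inE ?eqxx ?orbT // (splitsE _ sX) p1 andbF.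
- by apply: expand_out; rewrite ?inE ?eqxx ?orbT.
by apply: expand_in; rewrite // (splitsE _ sX) pD.
Qed.

Lemma expand_other_exchange X e f : splits D X -> e != p -> f != p -> e \in X.1 -> f \in X.2 ->
  B' (exchange X (e, f)).1 -> B' (exchange X (e, f)).2 ->
  exseq B (expand X) [:: (e, f)] (expand (exchange X (e, f))).
Proof.
move=> sX ep fp e1 f2 B1 B2.
have e2 : e \notin X.2 by rewrite (splitsE _ sX) e1 andbF.
have f1 : f \notin X.1 by move: f2; rewrite (splitsE _ sX) => /andP[].
have sX' : splits D (exchange X (e, f)) by apply: splits_exchange; rewrite // inE ?e2 ?f1.
have [_ _ [eq es]] := neq_detached (splits_in1 sX e1).
have [_ _ [fq fs]] := neq_detached (splits_in1 (splits_swap sX) f2).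
have eX : exchange (expand X) (e, f) = expand (exchange X (e, f)).
  rewrite /expand; have -> : (p \in (exchange X (e, f)).1) = (p \in X.1).
    by rewrite !inE ![p == _]eq_sym (negPf ep) (negPf fp).
  have qe : (q == e) = false by rewrite eq_sym.
  have qf : (q == f) = false by rewrite eq_sym.
  have se : (s == e) = false by rewrite eq_sym.
  have sf : (s == f) = false by rewrite eq_sym.
  have set1C (x y z : E) (T : {set E}) : (x == y) = false ->
      z |: ((x |: T) :\ y) = x |: (z |: (T :\ y)).
    move=> xy; apply/setP => g; rewrite !inE orbCA; congr (_ || _).
    by have [->|//] := eqVneq g x; rewrite xy.
  by case: ifP; rewrite /exchange /= !set1C.
have [BX1 BX2] := expand_B sX' B1 B2.
rewrite -eX in BX1 BX2 *; split=> //.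
  by rewrite /expand; case: ifP; rewrite !inE e1 eq es (negPf e2) orbT.
by rewrite /expand; case: ifP; rewrite !inE f2 fq fs (negPf f1) orbT.
Qed.

Lemma expand_step X st : splits D X -> st.1 \in X.1 -> st.2 \in X.2 ->
  B' (exchange X st).1 -> B' (exchange X st).2 ->
  exists S, [/\ exseq B (expand X) S (expand (exchange X st)), size S = (uses st p).+1
    & forall e, cnt e S = uses st (if e \in [:: q; s] then p else e)].
Proof.
case: st => e f /= sX e1 f2 B1 B2; have sX2 := splits_swap sX.
have e2 : e \notin X.2 by rewrite (splitsE _ sX) e1 andbF.
have f1 : f \notin X.1 by move: f2; rewrite (splitsE _ sX) => /andP[].
have [_ _ [eq es]] := neq_detached (splits_in1 sX e1).
have [_ _ [fq fs]] := neq_detached (splits_in1 sX2 f2).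
have [ep|ep] := eqVneq e p.
  rewrite {e}ep in e1 e2 eq es B1 B2 *.
  have [S [h1 h2 h3]] := expand_pivot_exchange sX e1 f2 B1 B2.
  exists S; split; rewrite // /uses /= ?eqxx ?h2 // => x; rewrite h3 !inE.
  have [->|_] := eqVneq x q; first by rewrite eqxx !orbT.
  have [->|_] := eqVneq x s; first by rewrite /= eqxx !orbT.
  by rewrite /= orbF orbC.
have [fp|fp] := eqVneq f p; last first.
  exists [:: (e, f)]; split; first exact: expand_other_exchange.
    by rewrite /uses /= ![p == _]eq_sym (negPf ep) (negPf fp).
  move=> x; rewrite /cnt /= addn0 !inE /uses /=.
  have [->|_] := eqVneq x q.
    by rewrite ![_ == e]eq_sym ![_ == f]eq_sym eq fq (negPf ep) (negPf fp).
  have [->|//] := eqVneq x s.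
  by rewrite ![_ == e]eq_sym ![_ == f]eq_sym es fs (negPf ep) (negPf fp).
rewrite {f}fp in f2 f1 fq fs B1 B2 *.
have [S [h1 h2 h3]] := expand_pivot_exchange sX2 f2 e1 B2 B1.
exists [seq (u.2, u.1) | u <- S]; split; rewrite /uses ?size_map ?h2 /= ?eqxx ?orbT //.
  have := exseq_swap h1; rewrite expand_swap //=.
  have -> : exchange (X.2, X.1) (p, e) = ((exchange X (e, p)).2, (exchange X (e, p)).1) by [].
  rewrite expand_swap /=; first by rewrite -!surjective_pairing.
  by apply: splits_exchange; rewrite // inE ?e2 ?f1.
move=> x; rewrite cnt_swap h3 !inE.
have [->|_] := eqVneq x q; first by rewrite eqxx !orbT.
have [->|_] := eqVneq x s; first by rewrite /= eqxx !orbT.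
by rewrite /= orbF.
Qed.

Lemma exseq_expand X S Y : splits D X -> exseq B' X S Y ->
  exists S', [/\ exseq B (expand X) S' (expand Y), size S' = size S + cnt p S
    & forall e, cnt e S' = cnt (if e \in [:: q; s] then p else e) S].
Proof.
elim: S X => [|st S IH] X sX /=; first by move=> <-; exists [::].
case=> s1 s2 B1 B2 /IH[|S2 [h1 h2 h3]]; first exact: splits_exchange.
move: s1 s2; rewrite !inE => /andP[_ s1] /andP[_ s2].
have [S1 [g1 g2 g3]] := expand_step sX s1 s2 B1 B2.
exists (S1 ++ S2); split; first exact: exseq_cat g1 h1.
  by rewrite size_cat g2 h2 /=; lia.
by move=> e; rewrite cnt_cat g3 h3.
Qed.

End Expand.

End ExchangeSequences.

(** * Vertices of degree two and three *)

Section Trees.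

Variables (E V : finType).
Implicit Types (en : E -> V * V) (T D A F : {set E}) (W : {set V}) (e : E).
Implicit Types (X Y : {set E} * {set E}).

Definition within en W D := {in D, forall e, (en e).1 \in W /\ (en e).2 \in W}.

Definition verts en F := \bigcup_(e in F) [set (en e).1; (en e).2].

(** The edges of D at v are exactly those of A, and none of them is a loop. *)
Definition star en W D v A :=
  [/\ A \subset D, {in A, forall e, exists2 w, w \in W :\ v & joins en e v w}
    & {in D :\: A, forall e, ~~ incident en v e}].

Lemma star_incident en W D v : within en W D ->
  {in D, forall e, (en e).1 != (en e).2} ->
  star en W D v [set e in D | incident en v e].
Proof.
move=> inW loopless; split; first by apply/subsetP => e; rewrite inE => /andP[].
  move=> e; rewrite inE => /andP[eD /incident_joins[w j]]; exists w => //.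
  have [] := inW e eD; have := loopless e eD; rewrite !inE.
  by case: j => -> /= vw ? ?; apply/andP; split; rewrite // eq_sym.
by move=> e; rewrite !inE => /andP[] /[swap] -> /=.
Qed.

Section Star.

Variables (en : E -> V * V) (W : {set V}) (D A : {set E}) (v : V).
Hypotheses (vW : v \in W) (sA : star en W D v A).

Lemma star_contract T w : T \subset D :\: A -> {in T, contract v w en =1 en}.
Proof.
case: sA => _ _ nA /subsetP sT e /sT /nA; rewrite /incident negb_or ![v == _]eq_sym.
by case/andP; apply: contract_id.
Qed.

(** If e is the only edge at v, then v is a leaf. *)
Lemma tree_leaf T e : e \in A -> T \subset D :\: A ->
  tree en W (e |: T) <-> tree en (W :\ v) T.
Proof.
move=> eA sT; have [_ /(_ e eA) [w wW j] _] := sA.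
have eT : e \notin T by apply/negP => /(subsetP sT); rewrite inE eA.
have ec := @star_contract T w sT.
split=> [/(tree_contract j vW wW eT)|tT]; first exact: tree_eq.
by apply/(tree_contract j vW wW eT); apply: tree_eq tT => f /ec.
Qed.

(** Removing the edge p, which joins the outer ends of p and q in the contracted
    graph, leaves two components, one containing the outer end of p and the other
    that of q.  The outer end of s lies in one of them; v is to be attached by s and
    by the edge leading to the other one.

    In terms of potentials: if both choices fail, take separating potentials P and
    Q.  Neither is constant along the removed edge, hence their sum is, and so the
    sum is constant off v.  But at the outer ends of s and p it takes different
    values, since P agrees with its value at v at both of them, and Q only at the
    first. *)
Lemma tree_mid T p q s q' : p \in A -> q \in A -> s \in A -> p != q -> p != s -> q != s ->
  joins en q v q' -> q' \in W :\ v -> T \subset D :\: A ->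
  tree (contract v q' en) (W :\ v) (p |: T) ->
  tree en W (s |: (p |: T)) \/ tree en W (s |: (q |: T)).
Proof.
move=> pA qA sA' pq ps qs jq q'W sT [sp cW].
have nT e : e \in A -> e \notin T by move=> eA; apply/negP => /(subsetP sT); rewrite inE eA.
have card_ok x : x \in A -> s != x -> #|W| = #|s |: (x |: T)|.+1.
  move=> xA sx; rewrite cardsU1 !inE negb_or sx nT // cardsU1 nT // (cardsD1 v W) vW cW.
  by rewrite cardsU1 nT.
have [_ starA _] := sA.
have [p' p'W jp] := starA p pA; have [s' s'W js] := starA s sA'.
have [?|[P fP [x [y [xW yW Pxy]]]]] := spansVcut en W (s |: (p |: T)).
  by left; split=> //; apply: card_ok; rewrite // eq_sym.
have [?|[Q fQ [x2 [y2 [x2W y2W Qxy]]]]] := spansVcut en W (s |: (q |: T)).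
  by right; split=> //; apply: card_ok; rewrite // eq_sym.
exfalso; have jn : joins (contract v q' en) p q' p'.
  have p'v : p' != v by move: p'W; rewrite !inE => /andP[].
  rewrite /joins /contract.
  by case: jp => ->; rewrite /= (merge_id _ p'v) merge_refl; [left|right].
have [Ps /(flatU1 _ _ jp) [Pp PT]] := (flatU1 _ _ js).1 fP.
have [Qs /(flatU1 _ _ jq) [Qq QT]] := (flatU1 _ _ js).1 fQ.
have cT R : flat en T R -> R q' = R p' -> {in W :\ v &, forall x y, R x = R y}.
  move=> fR Rqp; apply: sp; apply/(flatU1 _ _ jn); split=> //.
  by apply: eq_flat fR => e eT; rewrite (star_contract _ sT).
have ext (R : V -> bool) z : z \in W :\ v ->
    {in W :\ v &, forall x y, R x = R y} -> R v = R z ->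
    {in W &, forall x y, R x = R y}.
  move=> zW c Rv; have to_z u : u \in W -> R u = R z.
    by move=> uW; have [->//|uv] := eqVneq u v; apply: c; rewrite // !inE uv.
  by move=> ? ? /to_z -> /to_z ->.
have Pq : P q' != P p'.
  by apply: contraNneq Pxy => /(cT _ PT) c; apply/eqP; apply: (ext P p' p'W c Pp).
have Qp : Q q' != Q p'.
  by apply: contraNneq Qxy => /(cT _ QT) c; apply/eqP; apply: (ext Q q' q'W c Qq).
have fR : flat en T (fun z => P z (+) Q z) by move=> e eT; rewrite PT ?QT.
have := cT _ fR; have [Rqp|/negP[]] := boolP (P q' (+) Q q' == P p' (+) Q p').
  move=> /(_ (eqP Rqp) s' p' s'W p'W); rewrite -Ps -Qs Pp Qq.
  by case: (P p') (Q q') (Q p') Qp => [] [] [].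
by case: (P p') (P q') (Q p') (Q q') Pq Qp => [] [] [] [].
Qed.

End Star.

(** The induction statement.  For n = 1 the width bound 2 (n - 1) of the theorem
    would exclude the exchange of two parallel edges, hence the maximum with 1. *)
Definition exchange_claim n := forall en W D F X Y,
  #|W| = n.+1 -> within en W D -> splits D X -> splits D Y ->
  tree en W X.1 -> tree en W X.2 -> tree en W Y.1 -> tree en W Y.2 ->
  F \subset (X.1 :&: Y.1) :|: (X.2 :&: Y.2) -> #|verts en F| <= 3 ->
  exists S, [/\ exseq (tree en W) X S Y, {in F, forall e, cnt e S = 0},
    size S <= n ^ 2 & forall e, cnt e S <= maxn 1 (2 * (n - 1))].

Lemma within_star en W D v A : within en W D -> star en W D v A ->
  within en (W :\ v) (D :\: A).
Proof.
move=> inW [_ _ nA] e eDA; have := nA e eDA; rewrite /incident negb_or.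
rewrite !inE ![v == _]eq_sym; case/andP=> -> ->.
by case/setDP: eDA => /inW[-> ->].
Qed.

Lemma star_tree en W D v A T : star en W D v A -> v \in W -> 1 < #|W| ->
  T \subset D -> tree en W T -> exists2 e, e \in A & e \in T.
Proof.
move=> [_ _ nA] vW W1 /subsetP sT [/spans_incident/(_ W1 vW)[e eT ve] _]; exists e => //.
by apply: contraLR ve => eA; apply: nA; rewrite inE eA sT.
Qed.

Lemma splits_sub D X : splits D X -> X.1 \subset D /\ X.2 \subset D.
Proof. by move=> sX; split; [case: sX|case: (splits_swap sX)]. Qed.

Lemma splitsD D X (A : {set E}) : splits D X -> splits (D :\: A) (X.1 :\: A, X.2 :\: A).
Proof.
move=> sX; have [s1 s2] := splits_sub sX; split; first exact: setSD.
apply/setP => e; rewrite !inE (splitsE _ sX).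
by case: (e \in A); case: (e \in D); case: (e \in X.1).
Qed.

Lemma verts_sub en F F' : F' \subset F -> #|verts en F'| <= #|verts en F|.
Proof.
move=> /subsetP sF; apply/subset_leq_card/bigcupsP => e /sF eF.
exact: (bigcup_sup e).
Qed.

Lemma wbound_mono n : maxn 1 (2 * (n - 1)) <= maxn 1 (2 * (n.+1 - 1)).
Proof. lia. Qed.

Section Step.

Variables (n : nat) (IH : exchange_claim n) (en : E -> V * V) (W : {set V}) (D F : {set E}).
Variables (X Y : {set E} * {set E}) (v : V) (A : {set E}).
Hypotheses (cW : #|W| = n.+2) (inW : within en W D).
Hypotheses (vW : v \in W) (sA : star en W D v A).

Let AD : A \subset D. Proof. by case: sA. Qed.
Let cWv : #|W :\ v| = n.+1. Proof. by have := cardsD1 v W; rewrite vW cW => -[]. Qed.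
Let W1 : 1 < #|W|. Proof. by rewrite cW. Qed.

Definition tree_pair X := [/\ splits D X, tree en W X.1 & tree en W X.2].

Lemma tree_pair_swap Z : tree_pair Z -> tree_pair (Z.2, Z.1).
Proof. by case=> /splits_swap. Qed.

Lemma star2_edges Z : #|A| = 2 -> tree_pair Z -> exists a b,
  [/\ a != b, A = [set a; b], a \in Z.1 & b \in Z.2].
Proof.
move=> cA [sZ t1 t2]; have [s1 s2] := splits_sub sZ.
have [a aA a1] := star_tree sA vW W1 s1 t1; have [b bA b2] := star_tree sA vW W1 s2 t2.
have ab : a != b by apply: contraTneq b2 => <-; rewrite (splitsE _ sZ) a1 andbF.
exists a, b; split=> //; apply/esym/eqP; rewrite eqEcard cards2 ab cA leqnn andbT.
by rewrite subUset !sub1set aA.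
Qed.

Lemma star2_restore Z a b : tree_pair Z -> A = [set a; b] -> a \in Z.1 -> b \in Z.2 ->
  Z = (a |: (Z.1 :\: A), b |: (Z.2 :\: A)).
Proof.
case: Z => Z1 Z2 /= [sZ _ _] -> a1 b2; have := splitsE _ sZ; rewrite /= => EZ.
congr (_, _); apply/setP => e; rewrite !inE.
  have [->|_] := eqVneq e a; rewrite //=; have [->|//] := eqVneq e b.
  by apply/negbTE; move: b2; rewrite EZ => /andP[].
have [->|_] := eqVneq e b; rewrite ?orbT //=; have [->|//] := eqVneq e a.
by rewrite EZ a1 andbF.
Qed.

Lemma exchange_at_degree2 : #|A| = 2 -> tree_pair X -> tree_pair Y ->
  F \subset (X.1 :&: Y.1) :|: (X.2 :&: Y.2) -> #|verts en F| <= 3 ->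
  exists S, [/\ exseq (tree en W) X S Y, {in F, forall e, cnt e S = 0},
    size S <= n.+1 ^ 2 & forall e, cnt e S <= maxn 1 (2 * (n.+1 - 1))].
Proof.
move=> cA tX tY sF vF.
have [a [b [ab eA aX bX]]] := star2_edges cA tX.
have [sX _ _] := tX; have [sY _ _] := tY.
have [aA bA] : a \in A /\ b \in A by rewrite eA !inE !eqxx orbT.
have del Z x y : tree_pair Z -> A = [set x; y] -> x \in Z.1 -> y \in Z.2 ->
    tree en (W :\ v) (Z.1 :\: A) /\ tree en (W :\ v) (Z.2 :\: A).
  move=> tZ eA' x1 y2; have := tZ; rewrite {1}(star2_restore tZ eA' x1 y2).
  have [sZ _ _] := tZ; have [s1 s2] := splits_sub sZ.
  have [xA yA] : x \in A /\ y \in A by rewrite eA' !inE !eqxx orbT.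
  by case=> _ /= /(tree_leaf vW sA xA) h1 /(tree_leaf vW sA yA) h2; split;
    [apply: h1|apply: h2]; apply: setSD.
have [tX1 tX2] := del _ _ _ tX eA aX bX.
have [c [d [_ eA' cY dY]]] := star2_edges cA tY.
have [tY1 tY2] := del _ _ _ tY eA' cY dY.
have := IH cWv (within_star inW sA) (splitsD A sX) (splitsD A sY) tX1 tX2 tY1 tY2.
case/(_ (F :\: A)) => [||S [hS hF hs hc]].
- apply/subsetP => e; rewrite !inE => /andP[-> /(subsetP sF)]; by rewrite !inE.
- by apply: leq_trans (verts_sub _ _) vF; apply: subsetDl.
have hS0 e : e \in A -> cnt e S = 0.
  by move=> eIA; apply: (exseq_cnt0 (splitsD A sX) hS); rewrite inE eIA.
have disj x : x \in A -> [disjoint [set x] & D :\: A].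
  by move=> xA; rewrite disjoints1 inE xA.
have lift T : T \subset D :\: A -> tree en (W :\ v) T ->
    tree en W (a |: T) /\ tree en W (b |: T).
  by move=> sT tT; split; apply/(tree_leaf vW sA).
have := exseq_add (splitsD A sX) (disj a aA) (disj b bA) lift hS.
rewrite /= -(star2_restore tX eA aX bX).
have [aY|aY] := boolP (a \in Y.1).
  have bY : b \in Y.2.
    rewrite (splitsE _ sY) (subsetP AD) //=; apply/negP => bY.
    move: dY; rewrite (splitsE _ sY) => /andP[_]; apply/negP/negPn.
    by have : d \in A by [rewrite eA' !inE eqxx orbT]; rewrite eA !inE => /orP[]/eqP->.
  rewrite -(star2_restore tY eA aY bY) => h; exists S; split=> //.
  - by move=> e eF; have [/hS0//|eNA] := boolP (e \in A); apply: hF; rewrite inE eNA.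
  - by apply: leq_trans hs _; rewrite leq_exp2r.
  - by move=> e; apply: leq_trans (hc e) (wbound_mono n).
have {}aY : a \in Y.2 by rewrite (splitsE _ sY) (subsetP AD).
have bY : b \in Y.1.
  apply: contraT => bY; move: cY; have : c \in A by rewrite eA' !inE eqxx.
  rewrite eA !inE => /orP[]/eqP->; last by rewrite (negPf bY).
  by move: aY; rewrite (splitsE _ sY) => /andP[_ /negPf->].
have eA2 : A = [set b; a] by rewrite eA setUC.
have eY := star2_restore tY eA2 bY aY => h.
have E1 : b |: ((a |: Y.1 :\: A) :\ a) = Y.1.
  rewrite [in RHS]eY /=; apply/setP => e; rewrite !inE.
  by have [->|//] := eqVneq e a; rewrite aA.
have E2 : a |: ((b |: Y.2 :\: A) :\ b) = Y.2.
  rewrite [in RHS]eY /=; apply/setP => e; rewrite !inE.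
  by have [->|//] := eqVneq e b; rewrite bA.
(* a and b have to trade places; they do so after everything else is settled *)
exists (rcons S (a, b)); split.
- rewrite -cats1; apply: (exseq_cat h) => /=.
  rewrite !inE !eqxx (negPf ab) [b == a]eq_sym (negPf ab) aA bA E1 E2.
  by case: tY => _ ? ?; split; rewrite // /exchange /= E1 E2 -surjective_pairing.
- move=> e eF; have eNA : e \notin A.
    have := subsetP sF e eF; rewrite eA !inE !(splitsE _ sX) !(splitsE _ sY).
    have [->|_] := eqVneq e a.
      by rewrite aX; move: aY; rewrite (splitsE _ sY) => /andP[_ /negPf->]; rewrite !andbF.
    have [->|//] := eqVneq e b; rewrite bY; move: bX.
    by rewrite (splitsE _ sX) => /andP[_ /negPf->]; rewrite !andbF.
  rewrite -cats1 cnt_cat hF ?inE ?eNA // /cnt /= /uses /= addn0.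
  by apply/eqP; rewrite eqb0; move: eNA; rewrite eA !inE.
- by rewrite size_rcons; apply: (leq_ltn_trans hs); rewrite ltn_exp2r.
move=> e; rewrite -cats1 cnt_cat /cnt /= addn0 -/(cnt e S).
have [eIA|eNA] := boolP (e \in A); first by rewrite hS0 // add0n leq_max leq_b1.
have -> : uses (a, b) e = false by apply/negbTE; move: eNA; rewrite eA !inE.
by rewrite addn0; apply: leq_trans (hc e) (wbound_mono n).
Qed.

Lemma card3_split s : #|A| = 3 -> s \in A -> exists p q,
  [/\ A = [set p; q; s], p != q, p != s & q != s].
Proof.
move=> cA sIA; have /eqP/cards2P[p [q [pq epq]]] : #|A :\ s| = 2.
  by have := cardsD1 s A; rewrite cA sIA => -[].
exists p, q; split=> //; first by rewrite -epq setUC setD1K.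
  by have := set21 p q; rewrite -epq !inE => /andP[].
by have := set22 p q; rewrite -epq !inE => /andP[].
Qed.

(** Among the edges at v, s is alone in its part. *)
Definition single s (Z : {set E} * {set E}) :=
  {in A, forall e, (e \in Z.1) = (s \in Z.1) (+) (e != s)}.

Lemma singleP p q s Z : A = [set p; q; s] -> p != s -> q != s ->
  single s Z <-> (p \in Z.1) = (s \notin Z.1) /\ (q \in Z.1) = (s \notin Z.1).
Proof.
move=> eA /negPf ps /negPf qs; split=> [h|[hp hq] e].
  by rewrite (h p) ?(h q) ?eA ?inE ?eqxx ?orbT // ps qs addbT.
rewrite eA !inE -orbA => /or3P[]/eqP->; rewrite ?ps ?qs ?hp ?hq ?addbT //.
by rewrite eqxx addbF.
Qed.

Lemma single_swap s Z : splits D Z -> s \in A -> single s Z -> single s (Z.2, Z.1).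
Proof.
move=> sZ sIA h e eA; rewrite /= !(splitsE _ sZ) !(subsetP AD) //= h //.
by rewrite addNb.
Qed.

Lemma star3_single Z : #|A| = 3 -> tree_pair Z -> exists2 s, s \in A & single s Z.
Proof.
move=> cA [sZ t1 t2]; have [s1 s2] := splits_sub sZ.
have [a aA a1] := star_tree sA vW W1 s1 t1; have [b bA b2] := star_tree sA vW W1 s2 t2.
have {b2} b1 : b \notin Z.1 by move: b2; rewrite (splitsE _ sZ) => /andP[].
have [p [q [eA pq ps qs]]] := card3_split cA aA.
have [pA qA] : p \in A /\ q \in A by rewrite eA !inE !eqxx orbT.
have eAq : A = [set a; p; q] by apply/setP => z; rewrite eA !inE orbC orbA.
have eAp : A = [set q; a; p] by apply/setP => z; rewrite eA !inE -orbA orbC.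
have ap : a != p by rewrite eq_sym.
have aq : a != q by rewrite eq_sym.
have qp : q != p by rewrite eq_sym.
have [p1|p1] := boolP (p \in Z.1); have [q1|q1] := boolP (q \in Z.1).
- move: bA b1; rewrite eA !inE -orbA => /or3P[]/eqP->; by rewrite ?p1 ?q1 ?a1.
- by exists q => //; apply/(singleP _ eAq) => //; rewrite q1 a1 p1.
- by exists p => //; apply/(singleP _ eAp) => //; rewrite (negPf p1) a1 q1.
by exists a => //; apply/(singleP _ eA) => //; rewrite a1 (negPf p1) (negPf q1).
Qed.

Lemma exchange_back Z e f : splits D Z -> e \in Z.1 -> f \in Z.2 ->
  exchange (exchange Z (e, f)) (f, e) = Z.
Proof.
move=> sZ e1 f2; have e2 : e \notin Z.2 by rewrite (splitsE _ sZ) e1 andbF.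
have f1 : f \notin Z.1 by move: f2; rewrite (splitsE _ sZ) => /andP[].
rewrite [RHS]surjective_pairing /exchange /=; congr (_, _).
  by rewrite setU1K ?setD1K // !inE negb_and f1 orbT.
by rewrite setU1K ?setD1K // !inE negb_and e2 orbT.
Qed.

(** The part that does not contain s has the two other edges at v, and by [tree_mid]
    one of them can be replaced by s there.  In the other part v stays a leaf. *)
Lemma star3_move_right s Z : #|A| = 3 -> tree_pair Z -> s \in A -> single s Z -> s \in Z.2 ->
  exists x, [/\ x \in A, x != s, x \in Z.1, tree_pair (exchange Z (x, s)) &
    single x (exchange Z (x, s))].
Proof.
move=> cA [sZ t1 t2] sIA sgl s2; have [sub1 sub2] := splits_sub sZ.
have [p [q [eA pq ps qs]]] := card3_split cA sIA.
have s1 : s \notin Z.1 by move: s2; rewrite (splitsE _ sZ) => /andP[].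
have [] := (singleP _ eA ps qs).1 sgl; rewrite s1 => p1 q1.
have [pA qA] : p \in A /\ q \in A by rewrite eA !inE !eqxx orbT.
have [q' q'W jq] : exists2 w, w \in W :\ v & joins en q v w by case: sA => _ + _; apply.
have sT : Z.1 :\: A \subset D :\: A by apply: setSD.
have E1 : Z.1 = q |: (p |: (Z.1 :\: A)).
  apply/setP => e; rewrite eA !inE; have [->|_] := eqVneq e q; first by [].
  have [->|_] := eqVneq e p; first by [].
  by have [->|] := eqVneq e s; rewrite //= (negPf s1).
have E2 : Z.2 = s |: (Z.2 :\: A).
  apply/setP => e; rewrite eA !inE; have [->|_] := eqVneq e s; first by rewrite orbT.
  rewrite orbF /=; case: eqVneq => [->|_] /=; first by rewrite (splitsE _ sZ) p1 andbF.
  by case: eqVneq => [->|_] //=; rewrite (splitsE _ sZ) q1 andbF.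
have qnT : q \notin p |: (Z.1 :\: A) by rewrite !inE qA [q == p]eq_sym (negPf pq).
have out x y : x \in A -> y \in A -> x != y -> A = [set y; x; s] -> x != s ->
    tree en W (s |: (y |: (Z.1 :\: A))) ->
    [/\ x \in A, x != s, x \in Z.1, tree_pair (exchange Z (x, s)) &
      single x (exchange Z (x, s))].
  move=> xA yA xy eA' xs tx; have x1 : x \in Z.1 by rewrite sgl // (negPf s1).
  have ys : y != s.
    apply: contraTneq (introT eqP cA) => ys; rewrite eA' ys setUAC setUid cards2.
    by case: (s != x).
  have y1 : y \in Z.1 by rewrite sgl // (negPf s1).
  have E3 : s |: (Z.1 :\ x) = s |: (y |: (Z.1 :\: A)).
    apply/setP => e; rewrite [in RHS]eA' !inE; case: (eqVneq e s) => //= _.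
    by case: (eqVneq e y) => [->|_] /=; rewrite ?y1 1?eq_sym ?xy // orbF.
  have E4 : x |: (Z.2 :\ s) = x |: (Z.2 :\: A) by rewrite [in LHS]E2 setU1K // inE sIA.
  have x2 : x \notin Z.2 by rewrite (splitsE _ sZ) x1 andbF.
  split=> //.
    split; first by apply: (splits_exchange sZ); rewrite inE ?s1 ?x1 ?x2.
      by rewrite /exchange /= E3.
    rewrite /exchange /= E4; apply/(tree_leaf vW sA) => //; first exact: setSD.
    by apply/(tree_leaf vW sA sIA); [apply: setSD|rewrite -E2].
  have eA2 : A = [set y; s; x] by rewrite eA' setUAC.
  apply/(singleP _ eA2); rewrite 1?eq_sym //.
  by rewrite !inE (negPf xs) !eqxx y1 [y == x]eq_sym (negPf xy) orbT.
have tT : tree (contract v q' en) (W :\ v) (p |: (Z.1 :\: A)).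
  by apply/(tree_contract jq vW q'W qnT); rewrite -E1.
have [Bp|Bq] := tree_mid vW sA pA qA sIA pq ps qs jq q'W sT tT.
  by exists q; apply: (out q p) => //; rewrite eq_sym.
by exists p; apply: (out p q) => //; rewrite eA [[set p; q]]setUC.
Qed.

(** The return move is included because it is needed at the Y end of the sequence. *)
Lemma star3_move s Z : #|A| = 3 -> tree_pair Z -> s \in A -> single s Z ->
  exists x Z' S S', [/\ x \in A :\ s, tree_pair Z' /\ single x Z',
    exseq (tree en W) Z S Z' /\ exseq (tree en W) Z' S' Z,
    size S = 1 /\ size S' = 1 & forall e, e \notin A -> cnt e S = 0 /\ cnt e S' = 0].
Proof.
move=> cA tZ sIA sgl; have [sZ _ _] := tZ.
wlog s2 : Z tZ sgl sZ / s \in Z.2 => [wl|].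
  have [|s2] := boolP (s \in Z.2); first exact: wl.
  have s1 : s \in Z.1 by move: s2; rewrite (splitsE _ sZ) (subsetP AD) ?negbK.
  have [x [Z' [S [S' [xA [tZ' sgl'] [h1 h2] [z1 z2] c]]]]] :=
    wl _ (tree_pair_swap tZ) (single_swap sZ sIA sgl) (splits_swap sZ) s1.
  exists x, (Z'.2, Z'.1), [seq (u.2, u.1) | u <- S], [seq (u.2, u.1) | u <- S'].
  split; rewrite ?size_map //.
  - split; first exact: tree_pair_swap.
    apply: single_swap; [by case: tZ'|by case/setD1P: xA|exact: sgl'].
  - by have := exseq_swap h1; have := exseq_swap h2; rewrite /= -surjective_pairing.
  by move=> e /c; rewrite !cnt_swap.
have [x [xA xs x1 tZ' sgl']] := star3_move_right cA tZ sIA sgl s2.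
have x2 : x \notin Z.2 by rewrite (splitsE _ sZ) x1 andbF.
have s1 : s \notin Z.1 by move: s2; rewrite (splitsE _ sZ) => /andP[].
have [sZ' t1 t2] := tZ'.
exists x, (exchange Z (x, s)), [:: (x, s)], [:: (s, x)]; split=> //.
- by rewrite !inE xs.
- split; first by split; rewrite // !inE ?s1 ?s2 ?x1 ?x2.
  have eb := exchange_back sZ x1 s2; case: (tZ) => _ ? ?; split; rewrite ?eb //.
    by rewrite !inE !eqxx eq_sym (negPf xs) (negPf s1).
  by rewrite !inE !eqxx (negPf xs) (negPf x2).
- move=> e eA; have ex : e != x by apply: contraNneq eA => ->.
  have es : e != s by apply: contraNneq eA => ->.
  by rewrite /cnt /= /uses /= (negPf ex) (negPf es).
Qed.

(** With p and q the other edges at v, the smaller graph contracts q and deletes s;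
    its edge p joins the outer ends of p and q.  As F avoids the edges at v, both
    its edges and their ends survive, so the induction statement applies with the
    same F. *)
Lemma star3_same s Z1 Z2 : #|A| = 3 -> tree_pair Z1 -> tree_pair Z2 -> s \in A ->
  single s Z1 -> single s Z2 -> [disjoint F & A] ->
  F \subset (Z1.1 :&: Z2.1) :|: (Z1.2 :&: Z2.2) -> #|verts en F| <= 3 ->
  exists S, [/\ exseq (tree en W) Z1 S Z2, {in F, forall e, cnt e S = 0},
    size S <= n ^ 2 + maxn 1 (2 * (n - 1)) & forall e, cnt e S <= maxn 1 (2 * (n - 1))].
Proof.
move=> cA tZ1 tZ2 sIA sg1 sg2 FA sF vF.
have [p [q [eA pq ps qs]]] := card3_split cA sIA.
have [pA qA] : p \in A /\ q \in A by rewrite eA !inE !eqxx orbT.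
have [q' q'W jq] : exists2 w, w \in W :\ v & joins en q v w by case: sA => _ + _; apply.
have [p' p'W jp] : exists2 w, w \in W :\ v & joins en p v w by case: sA => _ + _; apply.
pose en' := contract v q' en; pose C := [set q; s].
have AE e : (e \in A) = (e == p) || (e \in C) by rewrite eA !inE orbA.
have pC : p \notin C by rewrite !inE negb_or pq.
have [qC sC] : q \in C /\ s \in C by rewrite !inE !eqxx orbT.
have toA T : T \subset D :\: C -> p \notin T -> T \subset D :\: A.
  move=> /subsetP sT pT; apply/subsetP => e eT; have := sT e eT.
  by have ep : e != p by [apply: contraNneq pT => <-]; rewrite !inE AE !inE (negPf ep).
have in_e T : T \subset D :\: C -> tree en' (W :\ v) T -> p \in T -> tree en W (q |: T).
  move=> sT tT pT; apply/(tree_contract jq vW q'W) => //.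
  by apply/negP => /(subsetP sT); rewrite inE qC.
have out_e T y : T \subset D :\: C -> tree en' (W :\ v) T -> p \notin T ->
    y \in [:: p; q; s] -> tree en W (y |: T).
  move=> sT tT pT yA; have sTA := toA T sT pT.
  have {}yA : y \in A by rewrite eA; move: yA; rewrite !inE orbA.
  by apply/(tree_leaf vW sA yA sTA); apply: tree_eq tT; apply: (star_contract sA).
have mid_e T : T \subset D :\: C -> tree en' (W :\ v) (p |: T) -> p \notin T ->
    tree en W (s |: (p |: T)) \/ tree en W (s |: (q |: T)).
  move=> sT tT pT; exact: (tree_mid vW sA pA qA sIA pq ps qs jq q'W (toA T sT pT) tT).
have shrink T : T \subset D -> (p \in T) = (s \notin T) -> (q \in T) = (s \notin T) ->
    tree en W T -> tree en' (W :\ v) (T :\: C).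
  move=> sT; have sTC : T :\: C \subset D :\: C by apply: setSD.
  have [sT' pT qT|sT' pT qT tT] := boolP (s \in T).
    have {1}-> : T = s |: (T :\: C).
      apply/setP => e; rewrite !inE; case: (eqVneq e s) => [->//|_] /=.
      by case: (eqVneq e q) => [->|_] //=; rewrite qT.
    have pTC : p \notin T :\: C by rewrite inE pT andbF.
    move/(tree_leaf vW sA sIA (toA _ sTC pTC)); apply: tree_eq => e eT.
    by rewrite /en' (star_contract sA _ (toA _ sTC pTC)).
  apply/(tree_contract jq vW q'W); first by rewrite inE qC.
  have <- // : T = q |: (T :\: C).
  apply/setP => e; rewrite !inE; case: (eqVneq e q) => [->//|_] /=.
  by case: (eqVneq e s) => [->|_] //=; rewrite (negPf sT').
have restore Z : tree_pair Z -> single s Z ->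
    [/\ expand p q s (Z.1 :\: C, Z.2 :\: C) = Z, tree en' (W :\ v) (Z.1 :\: C)
      & tree en' (W :\ v) (Z.2 :\: C)].
  move=> [sZ t1 t2] /(singleP _ eA ps qs)[p1 q1]; have [sub1 sub2] := splits_sub sZ.
  have [p2 q2] : (p \in Z.2) = (s \notin Z.2) /\ (q \in Z.2) = (s \notin Z.2).
    by rewrite !(splitsE _ sZ) !(subsetP AD) //= p1 q1.
  split; [|exact: shrink|exact: shrink].
  have s12 : (s \in Z.1) = (s \notin Z.2) by rewrite !(splitsE _ sZ) (subsetP AD) ?negbK.
  rewrite /expand inE (negPf pC) /= p1 [RHS]surjective_pairing.
  have q_set T : q \in T -> s \notin T -> q |: (T :\: C) = T.
    move=> qT /negPf sT; apply/setP => e; rewrite !inE; case: (eqVneq e q) => [->//|_] /=.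
    by case: (eqVneq e s) => [->|_] //=; rewrite sT.
  have s_set T : q \notin T -> s \in T -> s |: (T :\: C) = T.
    move=> /negPf qT sT; apply/setP => e; rewrite !inE; case: (eqVneq e s) => [->//|_] /=.
    by case: (eqVneq e q) => [->|_] //=; rewrite qT.
  case: (boolP (s \in Z.1)) s12 => [s1|s1] /esym s2 /=; congr (_, _).
  - by apply: s_set; rewrite // q1 s1.
  - by apply: q_set; rewrite // q2 s2.
  - by apply: q_set; rewrite // q1.
  - by apply: s_set; rewrite ?q2; move/negbFE: s2 => ->.
have [X1 tX1 tX2] := restore Z1 tZ1 sg1; have [Y1 tY1 tY2] := restore Z2 tZ2 sg2.
have [sZ1 _ _] := tZ1; have [sZ2 _ _] := tZ2.
have FE e : e \in F -> e \in D :\: A.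
  move=> eF; rewrite inE (disjointFr FA eF) /=; have := subsetP sF e eF.
  by have [h1 h2] := splits_sub sZ1; rewrite !inE => /orP[]/andP[+ _]; apply: subsetP.
have vF' : #|verts en' F| <= 3.
  rewrite (_ : verts en' F = verts en F) //; apply: eq_bigr => e eF.
  by rewrite /en' (star_contract sA q' (subxx _)) ?FE.
have inW' : within en' (W :\ v) (D :\: C).
  move=> e eD; have [->|ep] := eqVneq e p.
    move: (p'W) (q'W); rewrite !inE => /andP[p'v p'W'] /andP[q'v q'W'].
    by rewrite /en' /contract; case: jp => -> /=; rewrite merge_refl merge_id //
      p'v q'v p'W' q'W'.
  have eDA : e \in D :\: A by move: eD; rewrite !inE AE (negPf ep) !inE.
  by rewrite /en' (star_contract sA q' (subxx _)) //; apply: (within_star inW sA).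
have := IH cWv inW' (splitsD C sZ1) (splitsD C sZ2) tX1 tX2 tY1 tY2.
case/(_ F) => [|//|S [hS hF hs hc]].
  apply/subsetP => e eF; have := subsetP sF e eF; have := FE e eF.
  by rewrite !inE AE !inE !negb_or => /andP[/and3P[_ -> ->] _].
have qDC : q \notin D :\: C by rewrite inE qC.
have sDC : s \notin D :\: C by rewrite inE sC.
have pDC : p \in D :\: C by rewrite inE pC (subsetP AD).
have [S' [hS' hs' hc']] :=
  exseq_expand pDC qDC sDC qs in_e out_e mid_e (splitsD C sZ1) hS.
rewrite X1 Y1 in hS'; exists S'; split=> //.
- move=> e eF; rewrite hc' ifF ?hF //; have := FE e eF; rewrite !inE AE !inE.
  by rewrite !negb_or => /andP[/and3P[_ /negPf-> /negPf->] _].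
- by rewrite hs' leq_add.
by move=> e; rewrite hc'.
Qed.

(** Suppose that different edges s and t are alone in X and in Y.  If the move at X
    yields t, or the move at Y yields s, one move suffices; otherwise both moves
    yield the third edge. *)
Lemma exchange_at_degree3 : #|A| = 3 -> tree_pair X -> tree_pair Y ->
  [disjoint F & A] -> 1 < n ->
  F \subset (X.1 :&: Y.1) :|: (X.2 :&: Y.2) -> #|verts en F| <= 3 ->
  exists S, [/\ exseq (tree en W) X S Y, {in F, forall e, cnt e S = 0},
    size S <= n.+1 ^ 2 & forall e, cnt e S <= maxn 1 (2 * (n.+1 - 1))].
Proof.
move=> cA tX tY FA n1 sF vF.
have [s sIA sgX] := star3_single cA tX; have [t tIA sgY] := star3_single cA tY.
have [w [X' [Y' [SX [SY [[wA tX' tY'] [sgX' sgY'] [hX hY] [zX zY] c0]]]]]] :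
  exists w X' Y' SX SY, [/\ [/\ w \in A, tree_pair X' & tree_pair Y'],
    single w X' /\ single w Y', exseq (tree en W) X SX X' /\ exseq (tree en W) Y' SY Y,
    size SX <= 1 /\ size SY <= 1 & forall e, e \notin A -> cnt e SX = 0 /\ cnt e SY = 0].
  have [st|st] := eqVneq s t.
    by rewrite -st in sgY; exists s, X, Y, [::], [::]; split.
  have [x [X' [S [S' [/setD1P[xs xA] [tX' sgX'] [h1 h2] [z1 z2] c]]]]] :=
    star3_move cA tX sIA sgX.
  have [xt|xt] := eqVneq x t.
    rewrite xt in sgX'; exists t, X', Y, S, [::]; split; rewrite ?z1 //.
    by move=> e /c[].
  have [y [Y' [R [R' [/setD1P[yt yA] [tY' sgY'] [k1 k2] [r1 r2] c']]]]] :=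
    star3_move cA tY tIA sgY.
  have [ys|ys] := eqVneq y s.
    rewrite ys in sgY'; exists s, X, Y', [::], R'; split; rewrite ?r2 //.
    by move=> e /c'[].
  have xy : x = y.
    have [p [q [eA pq ps qs]]] := card3_split cA sIA.
    move: xA yA tIA; rewrite eA !inE (negPf xs) (negPf ys) [t == s]eq_sym (negPf st) !orbF.
    by move=> /orP[]/eqP ex /orP[]/eqP ey /orP[]/eqP et; subst; rewrite ?eqxx // in xt yt *.
  rewrite -xy in sgY'; exists x, X', Y', S, R'; split; rewrite ?z1 ?r2 //.
  by move=> e eA; have [-> _] := c e eA; have [_ ->] := c' e eA.
have eqF e : e \in F -> e \notin A by move=> eF; rewrite (disjointFr FA).
have [|S [hS hF hs hc]] := star3_same cA tX' tY' wA sgX' sgY' FA _ vF.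
  apply/subsetP => e eF; have := subsetP sF e eF; have [c1 c2] := c0 e (eqF e eF).
  by rewrite !inE !(exseq_unused hX c1) !(exseq_unused hY c2).
have max2 : maxn 1 (2 * (n - 1)) = 2 * (n - 1) by apply/maxn_idPr; lia.
rewrite max2 in hs hc.
have cle e S1 : size S1 <= 1 -> cnt e S1 <= 1 by apply: leq_trans; apply: count_size.
exists (SX ++ S ++ SY); split.
- by apply: (exseq_cat hX); apply: exseq_cat hS hY.
- by move=> e eF; have [c1 c2] := c0 e (eqF e eF); rewrite !cnt_cat c1 c2 hF.
- by rewrite !size_cat; move: zX zY hs n1; clear; nia.
move=> e; rewrite !cnt_cat leq_max; apply/orP; right.
by move: (cle e _ zX) (cle e _ zY) (hc e) n1; clear; lia.
Qed.

End Step.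

(** * Counting degrees *)

Definition edges_at en D v := [set e in D | incident en v e].

Lemma tree_pair_loopless en W D X : tree_pair en W D X ->
  {in D, forall e, (en e).1 != (en e).2}.
Proof.
case=> sX t1 t2 e eD; have [e1|e1] := boolP (e \in X.1); first exact: tree_loopless t1 e1.
by apply: tree_loopless t2 _; rewrite (splitsE _ sX) eD.
Qed.

Lemma tree_pair_card en W D X : tree_pair en W D X -> #|D|.+2 = #|W| + #|W|.
Proof.
case=> -[sX eX] [_ c1] [_ c2]; rewrite {1}c1 c2 eX cardsD (setIidPr sX).
by have := subset_leq_card sX; lia.
Qed.

Lemma sum_degree en W D : within en W D -> {in D, forall e, (en e).1 != (en e).2} ->
  \sum_(v in W) #|edges_at en D v| = 2 * #|D|.
Proof.
move=> inW loopless; under eq_bigr => v _ do rewrite -sum1_card.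
under eq_bigr => v _ do under eq_bigl => e do rewrite inE.
rewrite (exchange_big_dep [in D]) /=; last by move=> ? ? _ /andP[].
rewrite -[#|D|]sum1_card big_distrr; apply: eq_bigr => e eD /=.
rewrite sum1_card muln1; have [i1 i2] := inW e eD.
rewrite -[RHS](_ : #|[set (en e).1; (en e).2]| = 2); last by rewrite cards2 loopless.
apply: eq_card => v; rewrite !inE eD unfold_in /= /incident.
by case: eqP => [->|_]; [rewrite i1|case: eqP => [->|]; rewrite ?i2 ?andbF].
Qed.

Lemma degree_ge2 en W D X v : 1 < #|W| -> within en W D -> tree_pair en W D X -> v \in W ->
  1 < #|edges_at en D v|.
Proof.
move=> W1 inW tX vW; have sA := star_incident v inW (tree_pair_loopless tX).
have [sX t1 t2] := tX; have [s1 s2] := splits_sub sX.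
have [a aA a1] := star_tree sA vW W1 s1 t1; have [b bA b2] := star_tree sA vW W1 s2 t2.
apply/card_gt1P; exists a, b; split=> //.
by apply: contraTneq b2 => <-; rewrite (splitsE _ sX) a1 andbF.
Qed.

(** If all degrees are at least 3 and those off V(F) at least 4, then the degrees add
    up to at least 4 (n + 2) - 3, more than their actual sum 4 (n + 1).  Similarly, if
    all degrees are at least 3, then 3 (n + 2) <= 4 (n + 1), which forces n > 1. *)
Lemma low_degree n en W D F X : #|W| = n.+2 -> within en W D -> tree_pair en W D X ->
  #|verts en F| <= 3 -> exists2 v, v \in W &
  #|edges_at en D v| = 2 \/ [/\ #|edges_at en D v| = 3, v \notin verts en F & 1 < n].
Proof.
move=> cW inW tX vF; have W1 : 1 < #|W| by rewrite cW.
have deg2 v : v \in W -> 1 < #|edges_at en D v| := degree_ge2 W1 inW tX.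
have sumD := sum_degree inW (tree_pair_loopless tX).
have cD := tree_pair_card tX; rewrite cW in cD.
have [/exists_inP[v vW /orP h]|] := boolP [exists v in W, (#|edges_at en D v| == 2) ||
   [&& #|edges_at en D v| == 3, v \notin verts en F & 1 < n]].
  by exists v => //; case: h => [/eqP|/and3P[/eqP]]; [left|right].
rewrite negb_exists_in => /forall_inP no; exfalso.
have deg3 v : v \in W -> 2 < #|edges_at en D v|.
  by move=> vW; have := no v vW; have := deg2 v vW; lia.
have sum_const_W c : \sum_(v in W) c = n.+2 * c by rewrite sum_nat_const cW.
have [n1|n1] := leqP n 1.
  have : \sum_(v in W) 3 <= \sum_(v in W) #|edges_at en D v| by apply: leq_sum.
  by rewrite sum_const_W sumD; move: cD n1; clear; lia.
have : \sum_(v in W) 4 <= \sum_(v in W) (#|edges_at en D v| + (v \in verts en F)).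
  apply: leq_sum => v vW; have := deg3 v vW; have := no v vW; rewrite n1.
  by case: (v \in verts en F); lia.
rewrite big_split /= sum_const_W sumD.
have : \sum_(v in W) (v \in verts en F) <= #|verts en F|.
  apply: leq_trans (subset_leq_card (subsetIr W _)).
  rewrite -sum1_card (eq_bigl _ _ (fun v => in_setI v W _)) big_mkcondr.
  by apply: leq_sum => v _; case: (v \in verts en F).
by move: cD vF; clear; lia.
Qed.

Theorem tree_pairs_exchange n : exchange_claim n.
Proof.
elim: n => [|n IH] en W D F X Y cW inW sX sY tX1 tX2 tY1 tY2 sF vF.
  have empty T : tree en W T -> T = set0.
    by case=> _; rewrite cW => -[] /esym/eqP; rewrite cards_eq0 => /eqP.
  exists [::]; split=> //=.
  by apply: injective_projections; rewrite !(empty _ tX1, empty _ tX2);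
    rewrite !(empty _ tY1, empty _ tY2).
have tX : tree_pair en W D X by [].
have tY : tree_pair en W D Y by [].
have [v vW deg] := low_degree cW inW tX vF.
have sA := star_incident v inW (tree_pair_loopless tX).
have [cA|[cA vNF n1]] := deg.
  exact: (exchange_at_degree2 IH cW inW vW sA cA tX tY sF vF).
apply: (exchange_at_degree3 IH cW inW vW sA cA tX tY _ n1 sF vF).
rewrite disjoints_subset; apply/subsetP => e eF; rewrite !inE; apply: contra vNF.
by case/andP=> _ ve; apply/bigcupP; exists e; rewrite // !inE.
Qed.

End Trees.

(** * From bases of the graphic matroid to spanning trees *)

Section Transfer.

Variables (V E : finType) (G : multigraph V E).
Local Notation M := (graphic_matroid G).

Lemma pair_ends_ex e : exists uv : V * V, ends G e == [set uv.1; uv.2].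
Proof. by have [u [v ->]] := ends_pair G e; exists (u, v). Qed.

Definition pair_ends e : V * V := xchoose (pair_ends_ex e).

Lemma pair_endsE e : ends G e = [set (pair_ends e).1; (pair_ends e).2].
Proof. exact/eqP/(xchooseP (pair_ends_ex e)). Qed.

(** T connects whatever G connects; G itself may be disconnected. *)
Definition spanning (T : {set E}) :=
  forall p, flat pair_ends T p -> flat pair_ends setT p.

Lemma flat_connect T p u v : flat pair_ends T p -> connect (adj G T) u v -> p u = p v.
Proof.
move=> fp /connectP[c + ->]; elim: c u => //= x c IH u /andP[/exists_inP[e eT /eqP he] /IH <-].
have pe := fp e eT; have pn := neq_ends he; rewrite pair_endsE in he.
have : u \in [set u; x] by rewrite !inE eqxx.
have : x \in [set u; x] by rewrite !inE eqxx orbT.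
rewrite -he !inE => /orP[]/eqP hx /orP[]/eqP hu; rewrite hx hu ?pe //.
Qed.

Lemma connect_flat (T : {set E}) u : flat pair_ends T (connect (adj G T) u).
Proof.
move=> e eT; have csym := sym_connect_sym (adj_sym G T).
rewrite !(csym u); apply: (same_connect1 csym).
by apply/exists_inP; exists e; rewrite // pair_endsE.
Qed.

Lemma basis_spanning T : basis M T -> spanning T.
Proof.
move=> /maxsetP[fT maxT] p fp e _; have [eT|eT] := boolP (e \in T); first exact: fp.
apply: (flat_connect fp); apply: contraNT eT => /(forest_add fT (pair_endsE e)) fe.
by rewrite -(maxT _ fe (subsetU1 _ _)) setU11.
Qed.

(** A maximal forest inside T spans what T spans, and so cannot be enlarged in G. *)
Lemma spanning_basis T : spanning T -> exists2 T' : {set E}, T' \subset T & basis M T'.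
Proof.
move=> spT; have f0 : [pred A : {set E} | forest G A && (A \subset T)] set0.
  by rewrite /= forest0 sub0set.
have [A /maxsetP[/andP[fA sA] maxA] _] := maxset_exists f0.
exists A => //; apply/maxsetP; split=> // B fB sAB.
have key p : flat pair_ends A p -> flat pair_ends setT p.
  move=> fp; apply: spT => e eT; have [eA|eA] := boolP (e \in A); first exact: fp.
  apply: (flat_connect fp); apply: contraNT eA => /(forest_add fA (pair_endsE e)) fe.
  have h := maxA (e |: A); rewrite -h ?setU11 ?subsetU1 //.
  by rewrite inE fe subUset sub1set eT.
apply/eqP; rewrite eqEsubset sAB andbT; apply/subsetP => e eB; apply: contraT => eA.
have /negP[] := forest_bridge fB eB (pair_endsE e).
rewrite (_ : connect _ _ _ = true) //; apply: esym.
have sub : A \subset B :\ e by rewrite subsetD1 sAB.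
rewrite -(key (connect (adj G (B :\ e)) (pair_ends e).1)) ?connect0 ?inE //.
by move=> f fA'; apply: connect_flat; apply: (subsetP sub).
Qed.

Lemma basis_card T : basis M T -> #|T| = rank M.
Proof.
move=> /maxsetP[fT maxT]; apply/eqP; rewrite eqn_leq; apply/andP; split.
  exact: (@leq_bigmax_cond _ (indep M) (fun A : {set E} => #|A|) T fT).
apply/bigmax_leqP => A fA; rewrite leqNgt; apply/negP => lt.
have [e /setDP[_ eT] fe] := forest_augment fT fA lt.
by move: eT; rewrite -(maxT _ fe (subsetU1 _ _)) setU11.
Qed.

Lemma card_spanning_basis T : spanning T -> #|T| = rank M -> basis M T.
Proof.
move=> /spanning_basis[T' sT bT'] cT.
suff /eqP <- : T' == T by [].
by rewrite eqEcard sT cT (basis_card bT') /=.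
Qed.

Variable I : {set E}.

Let root_all v := root (adj G setT) v.

(** The quotient map that contracts I and glues the components of G at a root of
    each.  The glued vertex is [None]; other classes are represented by a root. *)
Definition squash v : option V :=
  if connect (adj G I) v (root_all v) then None else Some (root (adj G I) v).

Definition quot_ends e := (squash (pair_ends e).1, squash (pair_ends e).2).

Definition quot_vertices := None |: squash @: [set: V].

Let csymI := sym_connect_sym (adj_sym G I).
Let csymT := sym_connect_sym (adj_sym G setT).

Lemma adj_ends (T : {set E}) e : e \in T -> adj G T (pair_ends e).1 (pair_ends e).2.
Proof. by move=> eT; apply/exists_inP; exists e; rewrite // pair_endsE. Qed.

Lemma root_allE e : root_all (pair_ends e).1 = root_all (pair_ends e).2.
Proof. by apply/(rootP csymT)/connect1/adj_ends. Qed.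

Lemma squashE e : e \in I -> squash (pair_ends e).1 = squash (pair_ends e).2.
Proof.
move=> eI; have c := connect1 (adj_ends eI).
by rewrite /squash root_allE (same_connect csymI c) (rootP csymI c).
Qed.

Lemma squash_in v : squash v \in quot_vertices.
Proof. by apply/setU1r/imset_f; rewrite inE. Qed.

Lemma quot_within D : within quot_ends quot_vertices D.
Proof. by move=> e _; rewrite !squash_in. Qed.

(** A potential on G that is flat on I descends to the quotient once it is normalised
    to vanish at the root of each component of G. *)
Lemma quot_spans T : spans quot_ends quot_vertices T <-> spanning (I :|: T).
Proof.
split=> [sp p fp|sp p fp].
  pose q (o : option V) := if o is Some y then p y (+) p (root_all y) else false.
  have fI : flat pair_ends I p by move=> e eI; apply: fp; rewrite inE eI.
  have qE v : q (squash v) = p v (+) p (root_all v).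
    rewrite /squash; case: ifP => [c|_] /=; first by rewrite (flat_connect fI c) addbb.
    have c := connect_root (adj G I) v; rewrite -(flat_connect fI c); congr (_ (+) p _).
    apply/esym/(rootP csymT); apply: connect_sub c => x y /exists_inP[e _ he].
    by apply: connect1; apply/exists_inP; exists e; rewrite ?inE.
  have fq : flat quot_ends T q.
    by move=> e eT; rewrite /= !qE root_allE fp // inE eT orbT.
  have q0 v : p v = p (root_all v).
    have := sp q fq (squash v) None (squash_in v) (setU11 _ _); rewrite qE /=.
    by case: (p v); case: (p _).
  by move=> e _; rewrite q0 [RHS]q0 root_allE.
have fpp : flat pair_ends (I :|: T) (p \o squash).
  by move=> e; rewrite inE => /orP[/squashE /= ->|/fp].
have to_None o : o \in quot_vertices -> p o = p None.
  rewrite !inE => /orP[/eqP->//|/imsetP[v _ ->]].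
  have c := connect_root (adj G setT) v.
  have fT : flat pair_ends setT (p \o squash) := sp _ fpp.
  have /= -> := flat_connect fT c.
  rewrite /squash -/(root_all v) (_ : root_all (root_all v) = root_all v) ?connect0 //.
  exact: root_root.
by move=> x y /to_None -> /to_None ->.
Qed.

(** The number of vertices of the quotient is obtained without counting components:
    a spanning tree inside T lifts to a spanning set inside the basis T, hence to T. *)
Lemma quot_tree T : basis M T -> I \subset T -> tree quot_ends quot_vertices (T :\: I).
Proof.
move=> bT sIT; have eT : I :|: T :\: I = T.
  by rewrite setDE setUIr setUCr setIT; apply/setUidPr.
have sp : spans quot_ends quot_vertices (T :\: I).
  by apply/quot_spans; rewrite eT; apply: basis_spanning.
have [||T' sT' tT'] := spans_tree _ _ sp.
- by apply/set0Pn; exists None; apply: setU11.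
- exact: quot_within.
suff <- : T' = T :\: I by [].
have [/quot_spans/spanning_basis[B sB bB] _] := tT'.
have sub : I :|: T' \subset T by rewrite -eT setUS.
have eB : B = T.
  apply/eqP; rewrite eqEcard (subset_trans sB sub).
  by rewrite !(basis_card bT, basis_card bB) leqnn.
apply/eqP; rewrite eqEsubset sT' subDset -eB //.
Qed.

Lemma quot_basis (T0 T : {set E}) : basis M T0 -> I \subset T0 -> [disjoint I & T] ->
  tree quot_ends quot_vertices T -> basis M (I :|: T).
Proof.
move=> bT0 sI0 dIT [/quot_spans sp cT]; apply: card_spanning_basis => //.
have [_] := quot_tree bT0 sI0; rewrite cT cardsD (setIidPr sI0) (basis_card bT0) => -[cT'].
have := subset_leq_card sI0; rewrite (basis_card bT0) cardsU cT'.
by move: dIT; rewrite -setI_eq0 => /eqP ->; rewrite cards0 subn0; apply: subnKC.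
Qed.

Lemma quot_verts F : #|verts quot_ends F| <= #|vertices_of G F|.
Proof.
apply: leq_trans (leq_imset_card squash _); apply/subset_leq_card/bigcupsP => e eF.
rewrite subUset !sub1set; apply/andP; split; apply: imset_f; apply/bigcupP; exists e => //;
  by rewrite pair_endsE !inE eqxx ?orbT.
Qed.

End Transfer.

Lemma exseq_exchange_sequence (E : finType) (M : matroid E) X S Y :
  exseq (basis M) X S Y -> exchange_sequence M X S Y.
Proof.
elim: S X => [|s S IH] X; first by move=> /= ->.
by case=> s1 s2 b1 b2 /IH; rewrite /= /symmetric_exchange s1 s2 /basis_pair b1 b2.
Qed.

Lemma avoiding_cnt (E : finType) (F : {set E}) S :
  {in F, forall e, cnt e S = 0} -> avoiding F S.
Proof.
move=> c0; apply/allP => s sS; apply/forall_inP => e /c0 /eqP; apply: contraL => us.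
by rewrite -lt0n -has_count; apply/hasP; exists s.
Qed.

Theorem theorem4p1 (V E : finType) (G : multigraph V E) (r : nat)
    (X Y : {set E} * {set E}) (F : {set E}) :
  let M := graphic_matroid G in
  rank M = r -> 2 <= r ->
  basis_pair M X -> basis_pair M Y -> compatible X Y ->
  F \subset (X.1 :&: Y.1) :|: (X.2 :&: Y.2) ->
  #|vertices_of G F| <= 3 ->
  exists S : seq (E * E),
    [/\ exchange_sequence M X S Y, avoiding F S,
        width S <= 2 * (r - 1) & size S <= r ^ 2].
Proof.
move=> M rM r2 /andP[bX1 bX2] /andP[bY1 bY2] [eqI eqU] sF vF.
pose I := X.1 :&: X.2; pose D := (X.1 :|: X.2) :\: I.
have [sI1 sI2] : I \subset X.1 /\ I \subset X.2 by rewrite subsetIl subsetIr.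
have [sJ1 sJ2] : I \subset Y.1 /\ I \subset Y.2 by rewrite /I eqI subsetIl subsetIr.
have splitX : splits D (X.1 :\: I, X.2 :\: I).
  split; first by rewrite setSD // subsetUl.
  by apply/setP => e; rewrite !inE; case: (e \in X.1); case: (e \in X.2).
have splitY : splits D (Y.1 :\: I, Y.2 :\: I).
  rewrite /D /I eqI eqU; split; first by rewrite setSD // subsetUl.
  by apply/setP => e; rewrite !inE; case: (e \in Y.1); case: (e \in Y.2).
have DI (T : {set E}) : T \subset D -> [disjoint I & T].
  by move=> sT; rewrite disjoint_sym (disjointWl sT) // -setI_eq0 setIDAC setDIl setDv setI0.
have restore (T : {set E}) : I \subset T -> I :|: T :\: I = T.
  by move=> sT; rewrite setDE setUIr setUCr setIT; apply/setUidPr.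
have [tX1 tX2] := (quot_tree bX1 sI1, quot_tree bX2 sI2).
have [tY1 tY2] := (quot_tree bY1 sJ1, quot_tree bY2 sJ2).
pose n := #|X.1 :\: I|; have cW : #|quot_vertices G I| = n.+1 by case: tX1.
have nr : n <= r by rewrite -rM -(basis_card bX1) subset_leq_card ?subsetDl.
have [||S [hS hF hs hc]] := tree_pairs_exchange (F := F :\: I) cW (@quot_within V E G I D)
    splitX splitY tX1 tX2 tY1 tY2.
- apply/subsetP => e; rewrite !inE => /andP[-> /(subsetP sF)].
  by rewrite !inE.
- apply: leq_trans (quot_verts _ _ _) (leq_trans _ vF).
  by apply/subset_leq_card/bigcupsP => e /setDP[eF _]; apply: (bigcup_sup e).
exists S; split.
- apply: exseq_exchange_sequence.
  have lift (T : {set E}) : T \subset D -> tree (quot_ends G I) (quot_vertices G I) T ->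
      basis M (I :|: T) /\ basis M (I :|: T).
    by move=> /DI dT tT; have := quot_basis bX1 sI1 dT tT.
  have := exseq_add (B := fun T => basis M T) splitX (DI D (subxx _)) (DI D (subxx _)) lift hS.
  by rewrite /= !restore // -!surjective_pairing.
- apply: avoiding_cnt => e eF; have [eI|eI] := boolP (e \in I).
    by apply: (exseq_cnt0 splitX hS); rewrite inE eI.
  by apply: hF; rewrite inE eI.
- apply/bigmax_leqP => e _; apply: leq_trans (hc e) _.
  by move: nr r2; clear; lia.
by apply: leq_trans hs _; rewrite leq_exp2r.
Qed.
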